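(* The following functionals are not computable in any $\mathsf{S}^2_k$: (1) any functional $\Phi:(\mathbb{R}\to\mathbb{R})\to\mathbb{R}$ such that for all usco $f:[0,1]\to[0,1]$, we have $\Phi(f)\in C_f$; (2) any functional $\Psi:(\mathbb{R}\to\mathbb{R})\to(\mathbb{R}^2\to\mathbb{R})$ such that for all usco $f:[0,1]\to[0,1]$, $\Psi(f,p,q)=\sup_{x\in[p,q]}f(x)$ for $p,q\in[0,1]$; (3) any functional $\zeta:(\mathbb{R}\to\mathbb{R})\to((\mathbb{N}\times\mathbb{N})\to\mathbb{Q}^2)$ such that for all usco $f:[0,1]\to[0,1]$ and any $n,m\in\mathbb{N}$, $\zeta(f,m,n)$ is (the pair of end-points of) an open interval such that $C_f=\bigcap_{n\in\mathbb{N}}\big(\bigcup_{m\in\mathbb{N}}\zeta(f,m,n)\big)$; (4) any functional $\varepsilon:(\mathbb{R}\to\mathbb{R})\to((\mathbb{R}\times\mathbb{N})\to\mathbb{N})$ such that for all usco $f:[0,1]\to[0,1]$, $\varepsilon(f)$ is a modulus of continuity for $f$; (5) any functional $\Xi:(\mathbb{R}\to\mathbb{R})\to((\mathbb{R}\times\mathbb{N})\to\mathbb{R})$ such that for all usco $f:[0,1]\to[0,1]$, $\Xi(f)=(f_n)_{n\in\mathbb{N}}$ is a sequence of continuous functions with pointwise limit $f$. In particular, each of these functionals computes, together with $\exists^2$, a Cantor realiser. These results remain valid if the functionals are additionally given the oscillation function $\mathrm{osc}_f$ as an input.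
   Context: Computability is Kleene's S1-S9 computability for total objects of finite type over $\mathbb{N}$ (metatheory ZFC). The partial relation $\{e\}(\vec\Phi)\simeq y$ ($y\in\mathbb{N}$, $\vec\Phi$ a list of finite-type objects) is inductively generated by: S1 successor $x+1$; S2 constants; S3 projection to a number argument; S4 composition $\{e_1\}(\{e_2\}(\vec\Phi),\vec\Phi)$; S5 primitive recursion; S6 permutation of arguments; S7 $\{e\}(f,x,\vec\Phi)=f(x)$ for $f\in\mathbb{N}^{\mathbb{N}}$; S8 $\{e\}(\Psi^{n+2},\vec\Phi)=\Psi(\lambda\xi^{n}.\{e_1\}(\xi,\Psi,\vec\Phi))$ when the inner function is total; S9 $\{e\}(d,\vec\Phi,\vec\Phi')=\{d\}(\vec\Phi)$. A functional is computable in $G$ if, after currying so that values are natural numbers, it equals $\lambda\vec\Phi.\{e\}(G,\vec\Phi)$ for some index $e$. Real numbers are represented by fast-converging Cauchy sequences of rationals (elements of $\mathbb{N}^{\mathbb{N}}$); functions $\mathbb{R}\to\mathbb{R}$ are maps on representations respecting equality of reals, and functions on $[0,1]$ are treated likewise (as inputs of type $\mathbb{R}\to\mathbb{R}$). Subsets of $\mathbb{R}$ are given by characteristic functions, with no further data. $[p,q]$ presupposes $p\le q$. $\exists^2:\mathbb{N}^{\mathbb{N}}\to\{0,1\}$ satisfies $\exists^2(f)=0\leftrightarrow(\exists n)(f(n)=0)$. For $k\ge1$, $\mathsf{S}^2_k:\mathbb{N}^{\mathbb{N}}\to\{0,1\}$ decides the truth of $\Sigma^1_k$-formulas (in normal form,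 with the input $f\in\mathbb{N}^{\mathbb{N}}$ as parameter); e.g. $\mathsf{S}^2=\mathsf{S}^2_1$ satisfies $\mathsf{S}^2(f)=0\leftrightarrow(\exists g\in\mathbb{N}^{\mathbb{N}})(\forall n)(f(\overline{g}n)=0)$, with $\overline{g}n$ the code of $(g(0),\dots,g(n-1))$. ''Not computable in any $\mathsf{S}^2_k$'' means that for no $k$ is a functional with the stated property computable in $\mathsf{S}^2_k$. $B(x,r)$ is the open ball with centre $x$ and radius $r$, taken relative to $[0,1]$ for functions on $[0,1]$. $C_f$ is the set of points of continuity of $f$. $f:[0,1]\to\mathbb{R}$ is usco (upper semi-continuous) if for every $x_0\in[0,1]$ and $y>f(x_0)$ there is $N\in\mathbb{N}$ with $f(z)<y$ for all $z\in B(x_0,\frac1{2^N})$. A modulus of continuity for $f$ (with $C_f\neq\emptyset$) is $F:(\mathbb{R}\times\mathbb{N})\to\mathbb{N}$ such that for all $k\in\mathbb{N}$, $x\in C_f$, $y\in[0,1]$: $|x-y|<\frac1{2^{F(x,k)}}\to|f(x)-f(y)|<\frac1{2^k}$. Oscillation: $\mathrm{osc}_f([a,b]):=\sup_{x\in[a,b]}f(x)-\inf_{x\in[a,b]}f(x)$ (similarly on balls) and $\mathrm{osc}_f(x):=\lim_{k\to\infty}\mathrm{osc}_f(B(x,\frac1{2^k}))$. A Cantor realiser is any $\Phi:\big((\mathbb{R}\to\{0,1\})\times(\mathbb{R}\to\mathbb{N})\big)\to\mathbb{R}$ such that $\Phi(A,Y)\in[0,1]\setminus A$ whenever $A\subset[0,1]$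 is non-empty and $Y:[0,1]\to\mathbb{N}$ is injective on $A$. *)

(* Defs.v *)
From Stdlib Require Import Reals QArith Qreals Arith List Permutation Cantor ClassicalEpsilon.
From Coquelicot Require Import Coquelicot.
Import ListNotations.
Open Scope R_scope.

(** * Total objects of finite type over the natural numbers *)

Inductive ty : Set := tN | tArr (a b : ty).
Infix "~>" := tArr (at level 55, right associativity).

(** Full set-theoretic function spaces. *)
Fixpoint sem (t : ty) : Set :=
  match t with tN => nat | a ~> b => sem a -> sem b end.

(** Every type has the curried form [a1 ~> ... ~> ar ~> tN]; [args t] is the type
    of the tuples [(x1, ..., xr)] with [xi : sem ai]. *)
Fixpoint args (t : ty) : Set :=
  match t with tN => unit | a ~> b => (sem a * args b)%type end.

Fixpoint app (t : ty) : sem t -> args t -> nat :=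
  match t return sem t -> args t -> nat with
  | tN => fun x _ => x
  | a ~> b => fun h xs => app b (h (fst xs)) (snd xs)
  end.

Definition obj : Set := {t : ty & sem t}.
Definition Obj (t : ty) (x : sem t) : obj := existT sem t x.

Fixpoint objs (t : ty) : args t -> list obj :=
  match t return args t -> list obj with
  | tN => fun _ => []
  | a ~> b => fun xs => Obj a (fst xs) :: objs b (snd xs)
  end.

(** * Codes of finite sequences (a bijection from [list nat] to [nat]) *)

Fixpoint code (l : list nat) : nat :=
  match l with [] => O | a :: l' => S (Cantor.to_nat (a, code l')) end.

Definition initial (g : nat -> nat) (n : nat) : nat := code (map g (seq 0 n)).

(** * Kleene's S1-S9

    [Kleene e Phis y] is the relation {e}(Phis) = y. S8 is given for a
    functional [Psi] of an arbitrary type [a1 ~> ... ~> ar ~> tN] with r > 0: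
      {e}(Psi, Phis) = Psi(\xi. {d1}(xi, Psi, Phis), ..., \xi. {dr}(xi, Psi, Phis)),
    the i-th lambda binding the tuple of arguments of an object of type [ai] (no
    variable if [ai] is [tN]). When [Psi] has pure type n+2 we have r = 1 and a
    single bound variable xi of pure type n, which is Kleene's own S8; the general
    form makes it unnecessary to code objects of mixed type by objects of pure type. *)

Inductive Kleene : nat -> list obj -> nat -> Prop :=
| S1 : forall (x : nat) Phis,
    Kleene (code [1%nat]) (Obj tN x :: Phis) (S x)
| S2 : forall (q : nat) Phis,
    Kleene (code [2%nat; q]) Phis q
| S3 : forall (x : nat) Phis,
    Kleene (code [3%nat]) (Obj tN x :: Phis) x
| S4 : forall (e1 e2 z y : nat) Phis,
    Kleene e2 Phis z ->
    Kleene e1 (Obj tN z :: Phis) y ->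
    Kleene (code [4%nat; e1; e2]) Phis y
| S5_zero : forall (e1 e2 y : nat) Phis,
    Kleene e1 Phis y ->
    Kleene (code [5%nat; e1; e2]) (Obj tN O :: Phis) y
| S5_succ : forall (e1 e2 x z y : nat) Phis,
    Kleene (code [5%nat; e1; e2]) (Obj tN x :: Phis) z ->
    Kleene e2 (Obj tN x :: Obj tN z :: Phis) y ->
    Kleene (code [5%nat; e1; e2]) (Obj tN (S x) :: Phis) y
| S6 : forall (e1 : nat) (tau : list nat) (y : nat) Phis,
    Permutation tau (seq 0 (length Phis)) ->
    Kleene e1 (map (fun i => nth i Phis (Obj tN O)) tau) y ->
    Kleene (code [6%nat; e1; code tau]) Phis y
| S7 : forall (f : sem (tN ~> tN)) (x : nat) Phis,
    Kleene (code [7%nat]) (Obj (tN ~> tN) f :: Obj tN x :: Phis) (f x)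
| S8 : forall (ds : list nat) (t : ty) (Psi : sem t) (hs : args t) Phis,
    t <> tN ->
    length ds = length (objs t hs) ->
    (forall (i : nat) (o : obj),
        nth_error (objs t hs) i = Some o ->
        forall xi : args (projT1 o),
          Kleene (nth i ds O) (objs (projT1 o) xi ++ Obj t Psi :: Phis)
                 (app (projT1 o) (projT2 o) xi)) ->
    Kleene (code (8%nat :: ds)) (Obj t Psi :: Phis) (app t Psi hs)
| S9 : forall (d y : nat) Phis Phis',
    Kleene d Phis y ->
    Kleene (code [9%nat; length Phis]) (Obj tN d :: Phis ++ Phis') y.

Definition computable_in (G : list obj) (t : ty) (H : sem t) : Prop :=
  exists e : nat, forall xs : args t, Kleene e (G ++ objs t xs) (app t H xs).

(** * The functionals deciding existential and Sigma^1_k-formulas *)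

Definition E2 (f : nat -> nat) : nat :=
  if excluded_middle_informative (exists n, f n = O) then O else 1%nat.

Fixpoint tuple (l : list nat) : nat :=
  match l with
  | [] => O
  | [c] => c
  | c :: l' => Cantor.to_nat (c, tuple l')
  end.

(** [alternating f k true []] is the Sigma^1_k normal form
      (exists g1)(forall g2)...(Q gk)(Q' n) f(<g1|n, ..., gk|n>) = 0,
    where Q' is dual to Q: it is [forall] for odd k and [exists] for even k. *)
Fixpoint alternating (f : nat -> nat) (k : nat) (ex : bool) (gs : list (nat -> nat)) : Prop :=
  match k, ex with
  | O, true => exists n, f (tuple (map (fun g => initial g n) gs)) = O
  | O, false => forall n, f (tuple (map (fun g => initial g n) gs)) = O
  | S k', true => exists g, alternating f k' false (gs ++ [g])
  | S k', false => forall g, alternating f k' true (gs ++ [g])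
  end.

Definition S2k (k : nat) (f : nat -> nat) : nat :=
  if excluded_middle_informative (alternating f k true []) then O else 1%nat.

(** * Representations *)

(** The rational coded by <<a, b>, c> is (a - b) / (c + 1). *)
Definition rational (n : nat) : Q :=
  let (ab, c) := Cantor.of_nat n in
  let (a, b) := Cantor.of_nat ab in
  Qmake (Z.of_nat a - Z.of_nat b) (Pos.of_succ_nat c).

Definition tR : ty := tN ~> tN.
Definition tRR : ty := tR ~> tR.

Definition represents (x : sem tR) (r : R) : Prop :=
  (forall n i, Rabs (Q2R (rational (x n)) - Q2R (rational (x (n + i)%nat))) < / 2 ^ n) /\
  is_lim_seq (fun n => Q2R (rational (x n))) r.

Definition represents_fun (f : sem tRR) (F : R -> R) : Prop :=
  forall x r, represents x r -> represents (f x) (F r).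

Definition represents_set (a : sem (tR ~> tN)) (A : R -> Prop) : Prop :=
  forall x r, represents x r -> (A r -> a x = 1%nat) /\ (~ A r -> a x = O).

Definition represents_nat_fun (h : sem (tR ~> tN)) (Y : R -> nat) : Prop :=
  forall x r, represents x r -> h x = Y r.

(** * Functions on the unit interval

    A function on [0,1] is given by a function on all reals, whose values outside
    of [0,1] play no role. *)

Definition I01 (x : R) : Prop := 0 <= x <= 1.
Definition ball01 (x r y : R) : Prop := I01 y /\ Rabs (y - x) < r.

Definition cont_at (F : R -> R) (x : R) : Prop :=
  I01 x /\ filterlim F (within I01 (locally x)) (locally (F x)).

Definition usco (F : R -> R) : Prop :=
  forall x0 y, I01 x0 -> F x0 < y ->
  exists N : nat, forall z, ball01 x0 (/ 2 ^ N) z -> F z < y.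

Definition sup_on (F : R -> R) (D : R -> Prop) : R :=
  real (Lub_Rbar (fun y => exists x, D x /\ y = F x)).
Definition inf_on (F : R -> R) (D : R -> Prop) : R :=
  real (Glb_Rbar (fun y => exists x, D x /\ y = F x)).

Definition osc_on (F : R -> R) (D : R -> Prop) : R := sup_on F D - inf_on F D.
Definition osc (F : R -> R) (x : R) : R :=
  real (Lim_seq (fun k => osc_on F (ball01 x (/ 2 ^ k)))).

Definition modulus (F : R -> R) (M : R -> nat -> nat) : Prop :=
  forall k x y, cont_at F x -> I01 y ->
    Rabs (x - y) < / 2 ^ M x k -> Rabs (F x - F y) < / 2 ^ k.

(** * The five problems: what an output has to satisfy for the input function [F] *)

Definition cont_point (F : R -> R) (x : sem tR) : Prop :=
  exists r, represents x r /\ cont_at F r.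

Definition supremum (F : R -> R) (s : sem (tR ~> tR ~> tR)) : Prop :=
  exists G : R -> R -> R,
    (forall x y p q, represents x p -> represents y q -> represents (s x y) (G p q)) /\
    (forall p q, I01 p -> I01 q -> p <= q -> G p q = sup_on F (fun x => p <= x <= q)).

Definition left_end (c : nat) : R := Q2R (rational (fst (Cantor.of_nat c))).
Definition right_end (c : nat) : R := Q2R (rational (snd (Cantor.of_nat c))).

Definition cont_set (F : R -> R) (z : sem (tN ~> tN ~> tN)) : Prop :=
  (forall m n, left_end (z m n) < right_end (z m n)) /\
  (forall r, cont_at F r <->
     forall n, exists m, left_end (z m n) < r < right_end (z m n)).

Definition cont_modulus (F : R -> R) (e : sem (tR ~> tN ~> tN)) : Prop :=
  exists M : R -> nat -> nat,
    (forall k, represents_nat_fun (fun x => e x k) (fun r => M r k)) /\ modulus F M.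

Definition cont_approx (F : R -> R) (X : sem (tR ~> tN ~> tR)) : Prop :=
  exists Fn : nat -> R -> R,
    (forall n, represents_fun (fun x => X x n) (Fn n)) /\
    (forall n, continuous_on I01 (Fn n)) /\
    (forall r, I01 r -> is_lim_seq (fun n => Fn n r) (F r)).

(** A functional has to cope with every representative [f] of [F], but need not give
    the same output on different representatives. *)
Definition solves (t : ty) (P : (R -> R) -> sem t -> Prop) (Phi : sem (tRR ~> t)) : Prop :=
  forall F f, usco F -> (forall x, I01 x -> I01 (F x)) ->
    represents_fun f F -> P F (Phi f).

Definition solves_with_osc (t : ty) (P : (R -> R) -> sem t -> Prop)
    (Phi : sem (tRR ~> tRR ~> t)) : Prop :=
  forall F f O g, usco F -> (forall x, I01 x -> I01 (F x)) ->
    (forall x, I01 x -> O x = osc F x) ->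
    represents_fun f F -> represents_fun g O -> P F (Phi f g).

Definition Cantor_realiser (Theta : sem ((tR ~> tN) ~> (tR ~> tN) ~> tR)) : Prop :=
  forall a A y Y,
    represents_set a A -> represents_nat_fun y Y ->
    (forall r, A r -> I01 r) -> (exists r, A r) ->
    (forall r s, A r -> A s -> Y r = Y s -> r = s) ->
    exists r, represents (Theta a y) r /\ I01 r /\ ~ A r.

Definition not_computable_in_any_S2k (t : ty) (P : sem t -> Prop) : Prop :=
  forall k, (1 <= k)%nat -> forall Phi : sem t, P Phi ->
    ~ computable_in [Obj (tR ~> tN) (S2k k)] t Phi.

Definition computes_Cantor_realiser (t : ty) (P : sem t -> Prop) : Prop :=
  forall Phi : sem t, P Phi ->
    exists Theta, Cantor_realiser Theta /\
      computable_in [Obj t Phi; Obj (tR ~> tN) E2] ((tR ~> tN) ~> (tR ~> tN) ~> tR) Theta.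

(* Main.v *)
From Stdlib Require Import Reals QArith List Permutation Cantor ClassicalEpsilon.
From Stdlib Require Import Lia Lra Eqdep_dec FunctionalExtensionality.
From Coquelicot Require Import Coquelicot.
From mathcomp Require classical_sets.
Require Import Defs.
Import ListNotations.
Open Scope R_scope.

(** Let [A] be a subset of [0,1] on which [Y] is injective. The spike function F, with value
    1 / (Y x + 1) at x in [A] and 0 elsewhere, has only finitely many values above any positive
    bound. Hence F is usco, its oscillation function is F itself, and, as [A] is countable and so
    has a dense complement, its continuity points are exactly the points off [A]. Each of the
    five problems, posed for F, therefore contains the task of finding a real off [A], which
    is what a Cantor realiser does; and where the oscillation function is a further input, the
    same representative of F can be supplied twice.

    Finding the real. A continuity point is such a real. In the other four problems the
    output gives, for each n, a test for rational intervals such that intervals that pass can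
    be found inside any interval, and such that a real which for all n lies in an interval that
    passes the n-th test is off [A]. A Baire category argument ([point_spec]) then produces such
    a real as the limit of a nested sequence of intervals that pass, and its binary digits are
    read off with E2. Only values of the output at numbers and at constant names of rationals
    enter ([finder] and its five instances). A modulus of continuity says nothing about points
    of [A], so the rationals at which it is sampled have to be off [A]; E2 decides whether a real
    is rational, and the rationals are removed from [A]. The real found is made irrational in turn,
    and thus is off the original set as well. This is carried out in S1-S9 in [computes_realiser].

    Non-computability. Suppose that the index e computes a solution from some functional G of
    type 2. Computations only ever evaluate F at reals that are themselves denoted by an index
    together with finitely many parameters from a countable list, so the label Y of a real can be
    taken to be a code of a computation of this real, and codes determine what they denote. That
    circular requirement (the computation itself uses F) is met by Zorn's lemma: a partial labelling
    is admissible if every label denotes the real that it labels, where denotation refers to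
    computations with the partial spike function; denotation is monotone, so there is a maximal
    admissible labelling ([maximal_labelling]). By maximality every denoted real is labelled, hence
    no computation asks for a value of F outside of the domain of the labelling, and computations
    with the partial and with the total spike function agree ([Kleene_PKleene]). With [A] the set
    of labelled reals, the values of the alleged solution are thus denoted, and so is the real off
    [A] that is found from them; being denoted it lies in [A], which is absurd
    ([not_computable_in_type2]). As G is arbitrary, all functionals S2k are covered at once. *)

(** * Coding of pairs, lists and rationals *)

Lemma code_inj : forall l l', code l = code l' -> l = l'.
Proof.
  induction l as [|a l IH]; intros [|b l'] H; try discriminate; auto.
  change (S (to_nat (a, code l)) = S (to_nat (b, code l'))) in H. apply eq_add_S in H.
  assert (E : (a, code l) = (b, code l')).
  { rewrite <- (cancel_of_to (a, code l)), <- (cancel_of_to (b, code l')). now rewrite H. }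
  injection E as -> E. f_equal. now apply IH.
Qed.

Definition cpair (x y : nat) : nat := to_nat (x, y).
Definition cfst (n : nat) : nat := fst (of_nat n).
Definition csnd (n : nat) : nat := snd (of_nat n).

Lemma cfst_cpair x y : cfst (cpair x y) = x.
Proof. unfold cfst, cpair. now rewrite cancel_of_to. Qed.
Lemma csnd_cpair x y : csnd (cpair x y) = y.
Proof. unfold csnd, cpair. now rewrite cancel_of_to. Qed.
Lemma cpair_eta n : cpair (cfst n) (csnd n) = n.
Proof. unfold cfst, csnd, cpair. rewrite <- surjective_pairing. apply cancel_to_of. Qed.
Lemma cpair_ge_l x y : (x <= cpair x y)%nat.
Proof. unfold cpair. pose proof (to_nat_non_decreasing x y). lia. Qed.
Lemma cpair_ge_r x y : (y <= cpair x y)%nat.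
Proof. unfold cpair. pose proof (to_nat_non_decreasing x y). lia. Qed.

Definition ratR (i : nat) : R := Q2R (rational i).

Definition frac (a b c : nat) : nat := cpair (cpair a b) c.

Lemma ratR_eq i :
  ratR i = (INR (cfst (cfst i)) - INR (csnd (cfst i))) / (INR (csnd i) + 1).
Proof.
  unfold ratR, rational, cfst, csnd.
  destruct (of_nat i) as [ab c]; cbn [fst snd].
  destruct (of_nat ab) as [a b]; cbn [fst snd].
  unfold Q2R; cbn [Qnum Qden].
  rewrite minus_IZR, <- !INR_IZR_INZ.
  replace (IZR (Z.pos (Pos.of_succ_nat c))) with (INR c + 1); [reflexivity|].
  rewrite Znat.Zpos_P_of_succ_nat, succ_IZR, <- INR_IZR_INZ. lra.
Qed.

Lemma ratR_frac a b c : ratR (frac a b c) = (INR a - INR b) / (INR c + 1).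
Proof. rewrite ratR_eq. unfold frac. now rewrite !cfst_cpair, !csnd_cpair. Qed.

Lemma pow2_pos n : 0 < 2 ^ n.
Proof. apply pow_lt; lra. Qed.

Lemma INR_pow2 n : INR (2 ^ n) = 2 ^ n.
Proof. rewrite pow_INR. reflexivity. Qed.

Lemma INR_pow2_pred n : INR (2 ^ n - 1) + 1 = 2 ^ n.
Proof.
  assert (1 <= 2 ^ n)%nat by (pose proof (Nat.pow_nonzero 2 n); lia).
  rewrite minus_INR by assumption. rewrite INR_pow2. cbn. lra.
Qed.

Lemma ratR_dyadic a n : ratR (frac a 0 (2 ^ n - 1)) = INR a / 2 ^ n.
Proof. rewrite ratR_frac, INR_pow2_pred. cbn [INR]. now rewrite Rminus_0_r. Qed.

Definition Qleb (i j : nat) : bool :=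
  (cfst (cfst i) * S (csnd j) + csnd (cfst j) * S (csnd i) <=?
   cfst (cfst j) * S (csnd i) + csnd (cfst i) * S (csnd j))%nat.
Definition Qltb (i j : nat) : bool := negb (Qleb j i).

Lemma Qleb_spec i j : Qleb i j = true <-> ratR i <= ratR j.
Proof.
  unfold Qleb. rewrite Nat.leb_le, !ratR_eq.
  set (a := cfst (cfst i)). set (b := csnd (cfst i)). set (c := csnd i).
  set (a' := cfst (cfst j)). set (b' := csnd (cfst j)). set (c' := csnd j).
  pose proof (pos_INR c). pose proof (pos_INR c').
  assert (E : (a * S c' + b' * S c <= a' * S c + b * S c')%nat <->
     (INR a - INR b) * (INR c' + 1) <= (INR a' - INR b') * (INR c + 1)).
  { split; intros L.
    - apply le_INR in L. rewrite !plus_INR, !mult_INR, !S_INR in L. lra.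
    - apply INR_le. rewrite !plus_INR, !mult_INR, !S_INR. lra. }
  rewrite E. split; intros L.
  - apply Rmult_le_reg_r with ((INR c + 1) * (INR c' + 1)); [nra|].
    field_simplify; lra.
  - apply Rmult_le_compat_r with (r := (INR c + 1) * (INR c' + 1)) in L; [|nra].
    field_simplify in L; lra.
Qed.

Lemma Qltb_spec i j : Qltb i j = true <-> ratR i < ratR j.
Proof.
  unfold Qltb. rewrite Bool.negb_true_iff. pose proof (Qleb_spec j i) as H.
  destruct (Qleb j i); split; intros L; try discriminate; auto.
  - destruct H as [H _]. specialize (H eq_refl). lra.
  - apply Rnot_le_lt. intros L'. apply H in L'. discriminate.
Qed.

Definition add_dyadic (i n : nat) : nat :=
  frac (cfst (cfst i) * 2 ^ n + S (csnd i)) (csnd (cfst i) * 2 ^ n) (S (csnd i) * 2 ^ n - 1).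

Lemma ratR_add_dyadic i n : ratR (add_dyadic i n) = ratR i + / 2 ^ n.
Proof.
  unfold add_dyadic. rewrite ratR_frac, (ratR_eq i).
  pose proof (pos_INR (csnd i)). pose proof (pow2_pos n).
  assert (1 <= S (csnd i) * 2 ^ n)%nat.
  { apply Nat.mul_pos_pos; [lia | apply Nat.neq_0_lt_0, Nat.pow_nonzero; lia]. }
  rewrite minus_INR by assumption.
  rewrite !plus_INR, !mult_INR, !S_INR, INR_pow2. cbn [INR].
  replace ((INR (csnd i) + 1) * 2 ^ n - (0 + 1) + 1) with ((INR (csnd i) + 1) * 2 ^ n) by ring.
  field. split; apply Rgt_not_eq; lra.
Qed.

(** * Real numbers and their names *)

Lemma inv_pow2_lim : is_lim_seq (fun n => / 2 ^ n) 0.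
Proof.
  apply is_lim_seq_ext with (fun n => (/ 2) ^ n).
  - intros n. now rewrite pow_inv.
  - apply is_lim_seq_geom. rewrite Rabs_pos_eq; lra.
Qed.

Lemma inv_pow2_pos n : 0 < / 2 ^ n.
Proof. apply Rinv_0_lt_compat, pow2_pos. Qed.

Lemma inv_pow2_small eps : 0 < eps -> exists n, / 2 ^ n < eps.
Proof.
  intros He. pose proof inv_pow2_lim as H. apply is_lim_seq_spec in H.
  destruct (H (mkposreal eps He)) as [N HN]. exists N.
  specialize (HN N (Nat.le_refl _)). cbn [pos] in HN.
  rewrite Rminus_0_r, Rabs_pos_eq in HN; auto. left; apply inv_pow2_pos.
Qed.

Lemma inv_pow2_le m n : (m <= n)%nat -> / 2 ^ n <= / 2 ^ m.
Proof.
  intros L. apply Rinv_le_contravar; [apply pow2_pos|]. apply Rle_pow; auto; lra.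
Qed.

(** The Cauchy condition survives the limit, so a name comes with its rate of convergence. *)
Lemma represents_close x r n : represents x r -> Rabs (ratR (x n) - r) <= / 2 ^ n.
Proof.
  intros [H L].
  assert (L1 : is_lim_seq (fun i => Rabs (ratR (x n) - ratR (x (n + i)%nat)))
                 (Rabs (ratR (x n) - r))).
  { apply (is_lim_seq_abs _ (Finite _)). apply is_lim_seq_minus'; [apply is_lim_seq_const|].
    apply (is_lim_seq_incr_n _ n) in L.
    eapply is_lim_seq_ext; [|exact L]. intros i; cbn. now rewrite Nat.add_comm. }
  pose proof (is_lim_seq_le _ _ _ _ (fun i => Rlt_le _ _ (H n i)) L1 (is_lim_seq_const _)) as Q.
  exact Q.
Qed.

Lemma represents_const c : represents (fun _ => c) (ratR c).
Proof.
  split; [|apply is_lim_seq_const].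
  intros n i. rewrite Rminus_eq_0, Rabs_R0. apply inv_pow2_pos.
Qed.

Lemma represents_unique x r s : represents x r -> represents x s -> r = s.
Proof.
  intros [_ H] [_ H']. apply is_lim_seq_unique in H, H'.
  rewrite H in H'. now injection H'.
Qed.

Lemma rational_dense r s : r < s -> exists i, r < ratR i < s.
Proof.
  intros L. destruct (inv_pow2_small ((s - r) / 2)) as [n Hn]; [lra|].
  pose proof (pow2_pos n) as Hp.
  set (z := up (r * 2 ^ n)). pose proof (archimed (r * 2 ^ n)) as [Z1 Z2]. fold z in Z1, Z2.
  exists (frac (Z.to_nat z) (Z.to_nat (- z)) (2 ^ n - 1)).
  rewrite ratR_frac, INR_pow2_pred, !INR_IZR_INZ, <- minus_IZR.
  replace (Z.of_nat (Z.to_nat z) - Z.of_nat (Z.to_nat (- z)))%Z with z by lia.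
  assert (E : / 2 ^ n * 2 ^ n = 1) by (field; lra).
  split.
  - apply Rmult_lt_reg_r with (2 ^ n); auto. field_simplify; lra.
  - apply Rmult_lt_reg_r with (2 ^ n); auto. field_simplify; nra.
Qed.

Definition named (x : nat -> nat) : R := real (Lim_seq (fun n => ratR (x n))).

Lemma named_represents x r : represents x r -> named x = r.
Proof. intros [_ H]. apply is_lim_seq_unique in H. unfold named, ratR. now rewrite H. Qed.

(** * The Baire process *)

(** Quantification over the numbers as a truth value, in the form in which E2 delivers it. *)
Definition allb (P : nat -> bool) : bool := negb (E2 (fun k => Nat.b2n (P k)) =? 0)%nat.
Definition exb (P : nat -> bool) : bool := negb (allb (fun k => negb (P k))).

Lemma allb_spec P : allb P = true <-> forall k, P k = true.
Proof.
  unfold allb, E2. destruct excluded_middle_informative as [[n Hn]|N]; cbn.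
  - split; [discriminate|]. intros H. now rewrite H in Hn.
  - split; auto. intros _ k. destruct (P k) eqn:E; auto. destruct N. exists k. now rewrite E.
Qed.

Lemma exb_spec P : exb P = true <-> exists k, P k = true.
Proof.
  unfold exb. rewrite Bool.negb_true_iff, <- Bool.not_true_iff_false, allb_spec. split.
  - intros H. apply NNPP. intros N. apply H. intros k. apply Bool.negb_true_iff.
    apply Bool.not_true_iff_false. eauto.
  - intros [k Hk] H. specialize (H k). now rewrite Hk in H.
Qed.

(** A number codes a candidate: a level n, the rational end-points of an interval and a
    parameter that the test may use. The state of the process is the last accepted candidate. *)
Definition candidate (n i j N : nat) : nat := cpair n (cpair i (cpair j N)).
Definition lo (m : nat) : nat := cfst (csnd m).
Definition hi (m : nat) : nat := cfst (csnd (csnd m)).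
Definition wit (m : nat) : nat := csnd (csnd (csnd m)).

(** The new interval has to lie in the old one, to avoid the rational with the number of the
    current level, so that the limit is irrational, and to pass the test of this level. *)
Definition accept (tst : nat -> nat -> nat -> nat -> bool) (s m : nat) : bool :=
  ((cfst m =? S (cfst s)) && (Qleb (lo s) (lo m) && (Qleb (hi m) (hi s) && (Qltb (lo m) (hi m) &&
   ((Qltb (cfst s) (lo m) || Qltb (hi m) (cfst s)) &&
    tst (cfst s) (lo m) (hi m) (wit m))))))%nat%bool.

(** Stage t looks at the candidate [cfst t], so each candidate is looked at again and again. This
    replaces an unbounded search for the next interval: a stage may leave the state as it is,
    and the process is primitive recursive in the test. *)
Definition stage tst (s0 t : nat) : nat :=
  Nat.recursion s0 (fun x s => if accept tst s (cfst x) then cfst x else s) t.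

(** Written with [Nat.recursion] so that it matches the recursion scheme S5 literally. *)
Definition sumn (F : nat -> nat) (n : nat) : nat :=
  Nat.recursion O (fun x z => z + F x)%nat n.

(** The numerator of the limit of the left end-points, rounded down to a multiple of 1 / 2 ^ s. There
    is no bound for the stage at which the interval is shorter than that, so E2 decides whether a
    multiple is ever reached. *)
Definition digits tst s0 (s : nat) : nat :=
  sumn (fun i => Nat.b2n (exb (fun t => Qleb (frac (S i) 0 (2 ^ s - 1)) (lo (stage tst s0 t)))))
    (2 ^ s).

Definition point tst s0 (s : nat) : nat := frac (digits tst s0 s) 0 (2 ^ s - 1).

(** Counting the elements of an initial segment yields its length. *)
Lemma count_initial (P : nat -> bool) n :
  (forall i j, (i <= j)%nat -> P j = true -> P i = true) ->
  let k := sumn (fun i => Nat.b2n (P i)) n in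
  (k <= n)%nat /\ forall i, (i < n)%nat -> (P i = true <-> (i < k)%nat).
Proof.
  intros mono. cbv zeta. induction n as [|n [IH1 IH2]]; [split; [auto|lia]|].
  change (sumn (fun i => Nat.b2n (P i)) (S n)) with
    (sumn (fun i => Nat.b2n (P i)) n + Nat.b2n (P n))%nat.
  destruct (P n) eqn:E; cbn [Nat.b2n].
  - destruct (Nat.eq_dec (sumn (fun i => Nat.b2n (P i)) n) n) as [En|Nn].
    + rewrite En. split; [lia|]. intros i Hi. split; [lia|]. intros _. apply mono with n; auto; lia.
    + assert (H : P (sumn (fun i => Nat.b2n (P i)) n) = true) by (apply mono with n; auto).
      apply IH2 in H; lia.
  - split; [lia|]. intros i Hi. destruct (Nat.eq_dec i n) as [->|Ni].
    + rewrite E. split; [discriminate|lia].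
    + rewrite Nat.add_0_r. apply IH2. lia.
Qed.

Section Baire.
Variable tst : nat -> nat -> nat -> nat -> bool.
Variable s0 : nat.
Hypothesis s0_start :
  cfst s0 = O /\ 0 <= ratR (lo s0) /\ ratR (lo s0) < ratR (hi s0) /\ ratR (hi s0) <= 1.
Hypothesis tst_dense : forall n l r, 0 <= l -> l < r -> r <= 1 ->
  exists i j N, l <= ratR i /\ ratR i < ratR j /\ ratR j <= r /\ tst n i j N = true.

Lemma accept_spec s m : accept tst s m = true <->
  cfst m = S (cfst s) /\ ratR (lo s) <= ratR (lo m) /\ ratR (hi m) <= ratR (hi s) /\
  ratR (lo m) < ratR (hi m) /\
  (ratR (cfst s) < ratR (lo m) \/ ratR (hi m) < ratR (cfst s)) /\
  tst (cfst s) (lo m) (hi m) (wit m) = true.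
Proof.
  unfold accept. rewrite !Bool.andb_true_iff, Bool.orb_true_iff, Nat.eqb_eq, !Qltb_spec, !Qleb_spec.
  tauto.
Qed.

Let st := stage tst s0.

Lemma stage_S t : st (S t) = if accept tst (st t) (cfst t) then cfst t else st t.
Proof. reflexivity. Qed.

Lemma stage_step t : st (S t) = st t \/ accept tst (st t) (st (S t)) = true.
Proof.
  rewrite stage_S. destruct (accept tst (st t) (cfst t)) eqn:E; auto.
Qed.

Lemma stage_valid t :
  0 <= ratR (lo (st t)) /\ ratR (lo (st t)) < ratR (hi (st t)) /\ ratR (hi (st t)) <= 1 /\
  forall n, cfst (st t) = S n ->
    (ratR n < ratR (lo (st t)) \/ ratR (hi (st t)) < ratR n) /\
    tst n (lo (st t)) (hi (st t)) (wit (st t)) = true.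
Proof.
  induction t as [|t IH].
  - destruct s0_start as (E & H1 & H2 & H3). unfold st. cbn. repeat split; auto; congruence.
  - destruct (stage_step t) as [-> |H]; auto. apply accept_spec in H.
    destruct H as (E & H1 & H2 & H3 & H4 & H5), IH as (I1 & I2 & I3 & _).
    repeat split; try lra; rewrite E in H; injection H as <-; auto.
Qed.

Lemma stage_mono t t' : (t <= t')%nat ->
  ratR (lo (st t)) <= ratR (lo (st t')) /\ ratR (hi (st t')) <= ratR (hi (st t)) /\
  (cfst (st t) <= cfst (st t'))%nat /\ (cfst (st t) = cfst (st t') -> st t = st t').
Proof.
  induction 1 as [|t' L (I1 & I2 & I3 & I4)]; [repeat split; auto; lra|].
  destruct (stage_step t') as [-> |H]; auto. apply accept_spec in H.
  repeat split; try lra; try lia.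
Qed.

(** The level rises by at most one per stage, so none is skipped. *)
Lemma stage_passes t n t' : (t <= t')%nat -> cfst (st t) = n -> (n < cfst (st t'))%nat ->
  exists u, cfst (st u) = S n.
Proof.
  intros L E. induction L as [|t' L IH]; intros H; [lia|].
  destruct (stage_step t') as [Eq|Ha]; [rewrite Eq in H; auto|].
  apply accept_spec in Ha as [Ea _].
  destruct (stage_mono t t' L) as (_ & _ & M & _).
  destruct (Nat.eq_dec (cfst (st t')) n) as [En|Nn]; [exists (S t'); lia|].
  apply IH. lia.
Qed.

(** A candidate that would be accepted now exists by density. When it comes up again, either the
    level has risen in the meantime or the state is unchanged and the candidate is accepted. *)
Lemma stage_reaches n : exists t, cfst (st t) = n.
Proof.
  induction n as [|n [t IH]]; [exists O; apply s0_start|].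
  destruct (stage_valid t) as (V1 & V2 & V3 & _).
  set (a := ratR (lo (st t))) in *. set (b := ratR (hi (st t))) in *.
  assert (exists l r, a <= l /\ l < r /\ r <= b /\ (ratR n < l \/ r < ratR n))
    as (l & r & B1 & B2 & B3 & B4).
  { destruct (Rle_lt_dec (ratR n) ((a + b) / 2)).
    - exists ((a + 3 * b) / 4), b. repeat split; try lra.
    - exists a, ((a + b) / 2). repeat split; try lra. }
  destruct (tst_dense n l r) as (i & j & N & D1 & D2 & D3 & D4); try lra.
  set (m := candidate (S n) i j N).
  assert (Em : cfst m = S n /\ lo m = i /\ hi m = j /\ wit m = N).
  { unfold m, candidate, lo, hi, wit. now rewrite ?csnd_cpair, !cfst_cpair. }
  destruct Em as (M1 & M2 & M3 & M4).
  assert (Acc : accept tst (st t) m = true).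
  { apply accept_spec. rewrite IH, M1, M2, M3, M4. fold a b. repeat split; auto; lra. }
  assert (Lt : (t <= cpair m t)%nat) by apply cpair_ge_r.
  destruct (stage_mono t (cpair m t) Lt) as (_ & _ & M & Me).
  destruct (Nat.eq_dec (cfst (st t)) (cfst (st (cpair m t)))) as [E|Ne].
  - exists (S (cpair m t)). rewrite stage_S, <- (Me E), cfst_cpair, Acc. exact M1.
  - apply stage_passes with t (cpair m t); auto. lia.
Qed.

Lemma digits_spec s : exists k, digits tst s0 s = k /\
  (exists t, INR k / 2 ^ s <= ratR (lo (st t))) /\
  (INR k / 2 ^ s = 1 \/ forall t, ratR (lo (st t)) < INR k / 2 ^ s + / 2 ^ s).
Proof.
  pose proof (pow2_pos s) as Hp.
  set (P := fun i => exb (fun t => Qleb (frac (S i) 0 (2 ^ s - 1)) (lo (st t)))).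
  assert (HP : forall i, P i = true <-> exists t, INR (S i) / 2 ^ s <= ratR (lo (st t))).
  { intros i. unfold P. rewrite exb_spec.
    split; intros [t Ht]; exists t.
    - apply Qleb_spec in Ht. rewrite ratR_dyadic in Ht. exact Ht.
    - apply Qleb_spec. rewrite ratR_dyadic. exact Ht. }
  destruct (count_initial P (2 ^ s)) as [K1 K2].
  { intros i j L. rewrite !HP. intros [t Ht]. exists t. refine (Rle_trans _ _ _ _ Ht).
    apply Rmult_le_compat_r; [left; apply inv_pow2_pos|]. apply le_INR. lia. }
  exists (sumn (fun i => Nat.b2n (P i)) (2 ^ s)). split; [reflexivity|].
  set (k := sumn _ _) in *. clearbody k. split.
  - destruct k as [|k]; [|apply HP, K2; lia].
    exists O. cbn [INR]. unfold Rdiv. rewrite Rmult_0_l. apply stage_valid.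
  - destruct (Nat.eq_dec k (2 ^ s)) as [->|Nk].
    + left. rewrite INR_pow2. field. apply Rgt_not_eq; exact Hp.
    + right. intros t. apply Rnot_le_lt. intros H.
      assert (Hk : P k = true).
      { apply HP. exists t. rewrite S_INR. unfold Rdiv in *. lra. }
      apply K2 in Hk; lia.
Qed.

(** The limit is the supremum of the left end-points. It lies in all intervals of the process, and
    the digits approximate it from below. *)
Lemma point_spec : exists x, represents (point tst s0) x /\
  ratR (lo s0) <= x <= ratR (hi s0) /\ (forall i, x <> ratR i) /\
  forall n, exists i j N, 0 <= ratR i /\ ratR i <= x <= ratR j /\ ratR j <= 1 /\ tst n i j N = true.
Proof.
  destruct (completeness (fun y => exists t, y = ratR (lo (st t)))) as [x [Hub Hlub]].
  - exists 1. intros y [t ->]. pose proof (stage_valid t). lra.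
  - exists (ratR (lo (st O))). now exists O.
  - assert (Hx : forall t, ratR (lo (st t)) <= x <= ratR (hi (st t))).
    { intros t. split; [apply Hub; now exists t|]. apply Hlub. intros y [t' ->].
      pose proof (stage_valid t). pose proof (stage_valid t').
      destruct (Nat.le_ge_cases t t') as [L|L]; apply stage_mono in L; lra. }
    exists x. split; [|split; [|split]].
    + assert (close : forall s, x - / 2 ^ s <= ratR (point tst s0 s) <= x).
      { intros s. unfold point. rewrite ratR_dyadic.
        destruct (digits_spec s) as (k & -> & [t Ht] & Hk). split; [|pose proof (Hx t); lra].
        pose proof (inv_pow2_pos s).
        destruct Hk as [E|Hk]; [pose proof (Hx O); pose proof (stage_valid O); lra|].
        enough (x <= INR k / 2 ^ s + / 2 ^ s) by lra.
        apply Hlub. intros y [t' ->]. left. apply Hk. }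
      split.
      * intros n i. fold (ratR (point tst s0 n)) (ratR (point tst s0 (n + i)%nat)). unfold point.
        rewrite !ratR_dyadic. pose proof (inv_pow2_pos n) as Hn.
        pose proof (inv_pow2_le n (n + i) ltac:(lia)).
        destruct (digits_spec n) as (k & -> & [t Ht] & Hk).
        destruct (digits_spec (n + i)) as (k' & -> & [t' Ht'] & Hk').
        pose proof (stage_valid t) as (V1 & V2 & V3 & _).
        pose proof (stage_valid t') as (V1' & V2' & V3' & _).
        apply Rabs_def1.
        -- destruct Hk' as [E|Hk']; [|specialize (Hk' t)]; lra.
        -- destruct Hk as [E|Hk]; [|specialize (Hk t')]; lra.
      * apply is_lim_seq_spec. intros eps. destruct (inv_pow2_small eps (cond_pos eps)) as [N HN].
        exists N. intros n Hn. fold (ratR (point tst s0 n)). pose proof (close n).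
        pose proof (inv_pow2_le N n Hn). apply Rabs_def1; lra.
    + exact (Hx O).
    + intros i E. destruct (stage_reaches (S i)) as [t Ht].
      destruct (stage_valid t) as (_ & _ & _ & V). destruct (V i Ht) as [V' _].
      pose proof (Hx t). lra.
    + intros n. destruct (stage_reaches (S n)) as [t Ht].
      destruct (stage_valid t) as (V1 & V2 & V3 & V). destruct (V n Ht) as [_ V'].
      exists (lo (st t)), (hi (st t)), (wit (st t)). repeat split; auto; apply Hx.
Qed.
End Baire.

(** The Baire category theorem on [0,1], from the process above with an undecidable test:
    [point_spec] holds for arbitrary tests. *)
Lemma nested_points (Good : nat -> R -> R -> Prop) :
  (forall n l r l' r', Good n l r -> l <= l' -> r' <= r -> Good n l' r') ->
  (forall n l r, 0 <= l -> l < r -> r <= 1 ->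
     exists l' r', l <= l' /\ l' < r' /\ r' <= r /\ Good n l' r') ->
  forall l r, 0 <= l -> l < r -> r <= 1 ->
  exists x, l < x < r /\ forall n, exists l' r', Good n l' r' /\ l' <= x <= r'.
Proof.
  intros sub dense l r L0 Llr L1.
  set (tst := fun n i j (N : nat) =>
    if excluded_middle_informative (Good n (ratR i) (ratR j)) then true else false).
  destruct (rational_dense l r Llr) as [i Hi]. destruct (rational_dense (ratR i) r) as [j Hj]; [lra|].
  destruct (point_spec tst (candidate 0 i j 0)) as (x & _ & Hx & _ & H).
  - unfold candidate, lo, hi. rewrite ?csnd_cpair, !cfst_cpair. repeat split; lra.
  - intros n a b Ha Hab Hb. destruct (dense n a b Ha Hab Hb) as (a' & b' & H1 & H2 & H3 & H4).
    destruct (rational_dense a' b' H2) as [i' Hi'].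
    destruct (rational_dense (ratR i') b') as [j' Hj']; [lra|].
    exists i', j', O. repeat split; try lra. unfold tst.
    destruct excluded_middle_informative as [|N]; auto. destruct N.
    apply sub with a' b'; auto; lra.
  - exists x. unfold candidate, lo, hi in Hx. rewrite ?csnd_cpair, !cfst_cpair in Hx. split; [lra|].
    intros n. destruct (H n) as (i' & j' & N & _ & Hx' & _ & Ht). exists (ratR i'), (ratR j').
    split; auto. unfold tst in Ht. destruct excluded_middle_informative; auto; discriminate.
Qed.

(** * Spike functions *)

Definition spike (A : R -> Prop) (Y : R -> nat) (r : R) : R :=
  if excluded_middle_informative (A r) then / (INR (Y r) + 1) else 0.

Lemma ratR_spike y : ratR (frac 1 0 y) = / (INR y + 1).
Proof. rewrite ratR_frac. cbn [INR]. unfold Rdiv. ring. Qed.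

Lemma ratR_0 : ratR 0 = 0.
Proof. rewrite ratR_eq. unfold cfst, csnd. cbn. lra. Qed.

Section Spike.
Variables (A : R -> Prop) (Y : R -> nat).
Hypothesis A01 : forall r, A r -> I01 r.
Hypothesis Yinj : forall r s, A r -> A s -> Y r = Y s -> r = s.
Let F := spike A Y.

Lemma spike_on r : A r -> F r = / (INR (Y r) + 1).
Proof. intros H. unfold F, spike. now destruct excluded_middle_informative. Qed.

Lemma spike_off r : ~ A r -> F r = 0.
Proof. intros H. unfold F, spike. now destruct excluded_middle_informative. Qed.

Lemma spike_on_pos r : A r -> 0 < F r.
Proof.
  intros H. rewrite spike_on by auto. apply Rinv_0_lt_compat. pose proof (pos_INR (Y r)). lra.
Qed.

Lemma spike_range r : 0 <= F r <= 1.
Proof.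
  destruct (classic (A r)) as [H|H].
  - split; [left; now apply spike_on_pos|]. rewrite spike_on by auto.
    rewrite <- Rinv_1. apply Rinv_le_contravar; [lra|]. pose proof (pos_INR (Y r)). lra.
  - rewrite spike_off by auto. lra.
Qed.

Lemma spike_small r n : ~ (A r /\ (Y r < 2 ^ n)%nat) -> F r < / 2 ^ n.
Proof.
  intros H. destruct (classic (A r)) as [Ar|NA].
  - rewrite spike_on by auto.
    assert (L : (2 ^ n <= Y r)%nat) by (apply Nat.nlt_ge; auto).
    apply le_INR in L. rewrite INR_pow2 in L. pose proof (pow2_pos n).
    apply Rinv_lt_contravar; [|lra]. apply Rmult_lt_0_compat; lra.
  - rewrite spike_off by auto. apply inv_pow2_pos.
Qed.

(** By injectivity each label below N is taken at most once, so finitely many points are avoided. *)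
Lemma high_spikes_isolated x0 N :
  exists d, 0 < d /\ forall z, Rabs (z - x0) < d -> z <> x0 -> ~ (A z /\ (Y z < N)%nat).
Proof.
  induction N as [|N (d & Hd & IH)].
  - exists 1. split; [lra|]. intros z _ _ [_ H]. lia.
  - destruct (classic (exists z, A z /\ Y z = N /\ z <> x0)) as [(z0 & A0 & Y0 & N0)|None].
    + assert (0 < Rabs (z0 - x0)) by (apply Rabs_pos_lt; lra).
      exists (Rmin d (Rabs (z0 - x0))). split; [now apply Rmin_pos|].
      intros z Hz Nz [Az Yz]. pose proof (Rmin_l d (Rabs (z0 - x0))).
      pose proof (Rmin_r d (Rabs (z0 - x0))).
      destruct (Nat.eq_dec (Y z) N) as [E|E].
      * assert (z = z0) as -> by (apply Yinj; auto; congruence). lra.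
      * apply (IH z); [lra|auto|]. split; auto. lia.
    + exists d. split; auto. intros z Hz Nz [Az Yz].
      destruct (Nat.eq_dec (Y z) N) as [E|E]; [destruct None; eauto|].
      apply (IH z); auto. split; auto. lia.
Qed.

Lemma spike_locally_small x0 n :
  exists k, forall z, Rabs (z - x0) < / 2 ^ k -> z <> x0 -> F z < / 2 ^ n.
Proof.
  destruct (high_spikes_isolated x0 (2 ^ n)) as (d & Hd & H).
  destruct (inv_pow2_small d Hd) as [k Hk]. exists k. intros z Hz Nz.
  apply spike_small, H; auto. lra.
Qed.

Lemma spike_small_interval n l r : l < r ->
  exists l' r', l <= l' /\ l' < r' /\ r' <= r /\ forall z, l' <= z <= r' -> F z < / 2 ^ n.
Proof.
  intros L. destruct (spike_locally_small l n) as (k & H). pose proof (inv_pow2_pos k).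
  set (d := Rmin (/ 2 ^ k) (r - l)).
  assert (0 < d) by (apply Rmin_pos; lra).
  assert (d <= / 2 ^ k) by apply Rmin_l. assert (d <= r - l) by apply Rmin_r.
  exists (l + d / 3), (l + d / 2). repeat split; try lra.
  intros z Hz. apply H; [|lra]. rewrite Rabs_pos_eq; lra.
Qed.

(** [A] is countable: shrink to intervals on which the spikes become arbitrarily small. *)
Lemma off_dense l r : 0 <= l -> l < r -> r <= 1 -> exists x, l < x < r /\ ~ A x.
Proof.
  intros L0 L L1.
  destruct (nested_points (fun n a b => forall z, a <= z <= b -> F z < / 2 ^ n)) with (l := l) (r := r)
    as (x & Hx & H); auto.
  - intros n a b a' b' H Ha Hb z Hz. apply H. lra.
  - intros n a b _ Lab _. now apply spike_small_interval.
  - exists x. split; auto. intros Ax. apply spike_on_pos in Ax.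
    destruct (inv_pow2_small _ Ax) as [n Hn]. destruct (H n) as (a & b & Hab & Hx').
    specialize (Hab x Hx'). lra.
Qed.

Lemma usco_spike : usco F.
Proof.
  intros x0 y _ Hy. pose proof (spike_range x0).
  destruct (inv_pow2_small y) as [n Hn]; [lra|].
  destruct (spike_locally_small x0 n) as [k Hk]. exists k. intros z [_ Hz].
  destruct (Req_dec z x0) as [->|N]; auto. specialize (Hk z Hz N). lra.
Qed.

Lemma cont_at_iff (G : R -> R) x : cont_at G x <->
  I01 x /\ forall n, exists k, forall z, I01 z -> Rabs (z - x) < / 2 ^ k -> Rabs (G z - G x) < / 2 ^ n.
Proof.
  unfold cont_at. split; intros [Hx H]; split; auto.
  - intros n.
    destruct (proj1 (filterlim_locally G (G x)) H (mkposreal _ (inv_pow2_pos n))) as [d Hd].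
    destruct (inv_pow2_small d (cond_pos d)) as [k Hk]. exists k. intros z Iz Hz.
    apply Hd; auto. apply Rlt_trans with (/ 2 ^ k); auto.
  - apply filterlim_locally. intros eps.
    destruct (inv_pow2_small eps (cond_pos eps)) as [n Hn]. destruct (H n) as [k Hk].
    exists (mkposreal _ (inv_pow2_pos k)). intros z Hz Iz.
    apply Rlt_trans with (/ 2 ^ n); auto.
Qed.

(** At a point of [A] the function is positive but vanishes at points arbitrarily close by; off [A]
    all nearby spikes are small. *)
Lemma cont_at_spike x : cont_at F x <-> I01 x /\ ~ A x.
Proof.
  rewrite cont_at_iff. split; intros [Ix H]; split; auto.
  - intros Ax. pose proof (spike_on_pos x Ax) as Hp.
    destruct (inv_pow2_small _ Hp) as [n Hn]. destruct (H n) as [k Hk].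
    pose proof (inv_pow2_pos k). unfold I01 in Ix.
    assert (exists l r, 0 <= l /\ l < r /\ r <= 1 /\ x - / 2 ^ k < l /\ r < x + / 2 ^ k)
      as (l & r & H1 & H2 & H3 & H4 & H5).
    { destruct (Rlt_le_dec x 1).
      - exists x, (x + Rmin (1 - x) (/ 2 ^ k / 2)).
        pose proof (Rmin_l (1 - x) (/ 2 ^ k / 2)). pose proof (Rmin_r (1 - x) (/ 2 ^ k / 2)).
        assert (0 < Rmin (1 - x) (/ 2 ^ k / 2)) by (apply Rmin_pos; lra). repeat split; lra.
      - exists (x - Rmin 1 (/ 2 ^ k / 2)), x.
        pose proof (Rmin_l 1 (/ 2 ^ k / 2)). pose proof (Rmin_r 1 (/ 2 ^ k / 2)).
        assert (0 < Rmin 1 (/ 2 ^ k / 2)) by (apply Rmin_pos; lra). repeat split; lra. }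
    destruct (off_dense l r) as (z & Hz & NA); auto.
    assert (Hd : Rabs (F z - F x) < / 2 ^ n).
    { apply Hk; [unfold I01; lra|]. apply Rabs_def1; lra. }
    rewrite spike_off in Hd by auto. apply Rabs_def2 in Hd. lra.
  - intros n. destruct (spike_locally_small x n) as [k Hk]. exists k. intros z _ Hz.
    rewrite (spike_off x) by auto. rewrite Rminus_0_r, Rabs_pos_eq by apply spike_range.
    destruct (Req_dec z x) as [->|N]; auto. rewrite spike_off by auto. apply inv_pow2_pos.
Qed.
End Spike.

(** * Suprema and infima *)

Lemma sup_on_spec (G : R -> R) (D : R -> Prop) b x0 : D x0 -> (forall x, D x -> G x <= b) ->
  (forall x, D x -> G x <= sup_on G D) /\ forall c, (forall x, D x -> G x <= c) -> sup_on G D <= c.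
Proof.
  intros H0 Hb. unfold sup_on.
  set (E := fun y => exists x, D x /\ y = G x).
  destruct (Lub_Rbar_correct E) as [U Lst].
  assert (L1 : Rbar_le (G x0) (Lub_Rbar E)) by (apply U; now exists x0).
  assert (L2 : forall c, (forall x, D x -> G x <= c) -> Rbar_le (Lub_Rbar E) c).
  { intros c Hc. apply Lst. intros y (x & Hx & ->). now apply Hc. }
  pose proof (L2 b Hb) as L3. destruct (Lub_Rbar E) as [s| |]; try contradiction.
  split; [|exact L2]. intros x Hx. apply (U (G x)). now exists x.
Qed.

Lemma inf_on_eq (G : R -> R) (D : R -> Prop) x0 : D x0 -> (forall x, D x -> G x0 <= G x) ->
  inf_on G D = G x0.
Proof.
  intros H0 Hmin. unfold inf_on. erewrite is_glb_Rbar_unique with (l := Finite (G x0)); auto.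
  split.
  - intros y (x & Hx & ->). now apply Hmin.
  - intros b Hb. apply (Hb (G x0)). now exists x0.
Qed.

(** Every ball contains a zero, so the infimum vanishes and the oscillation is the limit of the
    suprema, which is the value at the centre by upper semi-continuity. *)
Lemma osc_spike A Y : (forall r, A r -> I01 r) ->
  (forall r s, A r -> A s -> Y r = Y s -> r = s) ->
  forall x, I01 x -> osc (spike A Y) x = spike A Y x.
Proof.
  intros A01 Yinj x Ix. unfold osc.
  erewrite is_lim_seq_unique with (l := Finite (spike A Y x)); auto.
  assert (Hk : forall k, spike A Y x <= osc_on (spike A Y) (ball01 x (/ 2 ^ k)) /\
    forall c, (forall z, ball01 x (/ 2 ^ k) z -> spike A Y z <= c) ->
      osc_on (spike A Y) (ball01 x (/ 2 ^ k)) <= c).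
  { intros k. pose proof (inv_pow2_pos k) as Hp.
    assert (Bx : ball01 x (/ 2 ^ k) x).
    { split; auto. rewrite Rminus_eq_0, Rabs_R0. auto. }
    destruct (sup_on_spec (spike A Y) (ball01 x (/ 2 ^ k)) 1 x Bx) as [S1 S2].
    { intros z _. apply spike_range. }
    assert (exists z, ball01 x (/ 2 ^ k) z /\ ~ A z) as (z & Bz & Nz).
    { apply NNPP. intros N.
      destruct (classic (A x)) as [Ax|NAx]; [|now apply N; exists x].
      destruct (off_dense A Y Yinj (Rmax 0 (x - / 2 ^ k / 2)) (Rmin 1 (x + / 2 ^ k / 2)))
        as (z & Hz & NA).
      - apply Rmax_l.
      - unfold I01 in Ix. apply Rmax_lub_lt; apply Rmin_glb_lt; lra.
      - apply Rmin_l.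
      - apply N. exists z. split; auto.
        pose proof (Rmax_l 0 (x - / 2 ^ k / 2)). pose proof (Rmax_r 0 (x - / 2 ^ k / 2)).
        pose proof (Rmin_l 1 (x + / 2 ^ k / 2)). pose proof (Rmin_r 1 (x + / 2 ^ k / 2)).
        split; [unfold I01; lra|]. apply Rabs_def1; lra. }
    unfold osc_on. rewrite (inf_on_eq _ _ z Bz).
    - rewrite (spike_off A Y z Nz), Rminus_0_r. split; auto.
    - intros z' _. rewrite (spike_off A Y z Nz). apply spike_range. }
  apply is_lim_seq_spec. intros eps.
  destruct (usco_spike A Y Yinj x (spike A Y x + eps / 2) Ix) as [N HN].
  { pose proof (cond_pos eps). lra. }
  exists N. intros k Lk. destruct (Hk k) as [H1 H2].
  assert (H3 : osc_on (spike A Y) (ball01 x (/ 2 ^ k)) <= spike A Y x + eps / 2).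
  { apply H2. intros z [Iz Hz]. left. apply HN. split; auto.
    pose proof (inv_pow2_le N k Lk). lra. }
  pose proof (cond_pos eps). apply Rabs_def1; lra.
Qed.

(** * Finding a real off the spikes *)

(** [sample] lists the arguments at which a solution H is evaluated and [name] turns the sequence of
    values into a name of a real off [A]. [D] restricts the sets [A] that are considered, and the
    real that is found obeys the same restriction. That [name] only sees a sequence of values of H
    serves both purposes: this sequence can be computed from H by S8, and for generic labels
    it is denoted by a single code. *)
Definition finder (t : ty) (P : (R -> R) -> sem t -> Prop) (D : R -> Prop)
    (sample : nat -> args t) (name : (nat -> nat) -> nat -> nat) : Prop :=
  forall A Y H, (forall r, A r -> I01 r /\ D r) ->
    (forall r s, A r -> A s -> Y r = Y s -> r = s) -> P (spike A Y) H ->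
    exists x, represents (name (fun k => app t H (sample k))) x /\ I01 x /\ D x /\ ~ A x.

Lemma finder_cont_point :
  finder tR cont_point (fun _ => True) (fun k => (k, tt)) (fun tau => tau).
Proof.
  intros A Y H HA HY (x & Hx & Hc).
  apply cont_at_spike in Hc; auto. exists x. split; [exact Hx|]. tauto.
Qed.

Definition irrational (x : R) : Prop := forall i, x <> ratR i.

(** Level 0 and the interval [0,1]. *)
Definition start : nat := candidate 0 0 (frac 1 0 0) 0.

(** As the real is irrational, it is interior to all the rational intervals that contain it. *)
Lemma baire_finder tst A :
  (forall n l r, 0 <= l -> l < r -> r <= 1 ->
     exists i j N, l <= ratR i /\ ratR i < ratR j /\ ratR j <= r /\ tst n i j N = true) ->
  (forall x, irrational x -> (forall n, exists i j N,
     0 <= ratR i /\ ratR i < x < ratR j /\ ratR j <= 1 /\ tst n i j N = true) -> ~ A x) ->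
  exists x, represents (point tst start) x /\ I01 x /\ irrational x /\ ~ A x.
Proof.
  intros dense sound.
  assert (E0 : ratR (lo start) = 0).
  { unfold start, candidate, lo. rewrite csnd_cpair, cfst_cpair. apply ratR_0. }
  assert (E1 : ratR (hi start) = 1).
  { unfold start, candidate, hi. rewrite !csnd_cpair, cfst_cpair, ratR_frac. cbn. field. }
  destruct (point_spec tst start) as (x & Hx & Ix & irr & H); auto.
  - rewrite E0, E1. unfold start, candidate. rewrite cfst_cpair. repeat split; lra.
  - rewrite E0, E1 in Ix. exists x. split; [exact Hx|split; [exact Ix|split; [exact irr|]]].
    apply sound; auto.
    intros n. destruct (H n) as (i & j & N & H1 & [H2 H3] & H4 & H5). exists i, j, N.
    pose proof (irr i). pose proof (irr j).
    repeat split; auto; lra.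
Qed.

Lemma off_of_small A Y x : (forall n, spike A Y x <= 3 * / 2 ^ n) -> ~ A x.
Proof.
  intros H Ax. apply (spike_on_pos A Y) in Ax.
  destruct (inv_pow2_small (spike A Y x / 3)) as [n Hn]; [lra|]. specialize (H n). lra.
Qed.

Lemma rationals_between l r : l < r -> exists i j, l < ratR i /\ ratR i < ratR j /\ ratR j < r.
Proof.
  intros L. destruct (rational_dense l r L) as [i Hi].
  destruct (rational_dense (ratR i) r) as [j Hj]; [lra|]. exists i, j. lra.
Qed.

(** * From suprema *)

Definition sample_sup (k : nat) : args (tR ~> tR ~> tR) :=
  (fun _ => cfst k, (fun _ => cfst (csnd k), (csnd (csnd k), tt))).

Definition test_sup (tau : nat -> nat) (n i j N : nat) : bool :=
  Qleb (tau (cpair i (cpair j n))) (frac 2 0 (2 ^ n - 1)).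

(** The test asks that the n-th approximation to the supremum is at most 2 / 2 ^ n. An interval that
    passes has supremum at most 3 / 2 ^ n. Conversely the test accepts all intervals
    on which F stays below 1 / 2 ^ n. *)
Lemma finder_supremum :
  finder (tR ~> tR ~> tR) supremum irrational sample_sup (fun tau => point (test_sup tau) start).
Proof.
  intros A Y s HA HY (G & HG & Hsup).
  assert (A01 : forall r, A r -> I01 r) by apply HA.
  set (tau := fun k => app (tR ~> tR ~> tR) s (sample_sup k)).
  assert (Htau : forall i j n,
    Rabs (ratR (tau (cpair i (cpair j n))) - G (ratR i) (ratR j)) <= / 2 ^ n).
  { intros i j n. unfold tau, sample_sup. cbn [app fst snd]. rewrite !csnd_cpair, !cfst_cpair.
    apply (represents_close (s (fun _ => i) (fun _ => j))).
    apply HG; apply represents_const. }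
  assert (Hs : forall i j, 0 <= ratR i -> ratR i < ratR j -> ratR j <= 1 ->
     (forall x, ratR i <= x <= ratR j -> spike A Y x <= G (ratR i) (ratR j)) /\
     forall c, (forall x, ratR i <= x <= ratR j -> spike A Y x <= c) -> G (ratR i) (ratR j) <= c).
  { intros i j Hi Hij Hj. rewrite Hsup by (unfold I01; lra).
    apply (sup_on_spec _ (fun x => ratR i <= x <= ratR j) 1 (ratR i)); [lra|].
    intros x _. apply spike_range. }
  apply baire_finder; fold tau.
  - intros n l r L0 L L1.
    destruct (spike_small_interval A Y HY n l r L) as (l' & r' & H1 & H2 & H3 & H4).
    destruct (rationals_between l' r' H2) as (i & j & Hi & Hij & Hj).
    exists i, j, O. repeat split; try lra. apply Qleb_spec. rewrite ratR_dyadic.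
    destruct (Hs i j) as [_ Hle]; try lra.
    specialize (Hle (/ 2 ^ n)). specialize (Htau i j n).
    assert (G (ratR i) (ratR j) <= / 2 ^ n) by (apply Hle; intros x Hx; left; apply H4; lra).
    apply Rabs_le_between in Htau. cbn [INR]. unfold Rdiv. lra.
  - intros x _ H. apply off_of_small with Y. intros n.
    destruct (H n) as (i & j & N & Hi & Hx & Hj & Ht).
    apply Qleb_spec in Ht. rewrite ratR_dyadic in Ht.
    destruct (Hs i j) as [Hle _]; try lra. specialize (Hle x ltac:(lra)).
    specialize (Htau i j n). apply Rabs_le_between in Htau.
    cbn [INR] in Ht. unfold Rdiv in Ht. lra.
Qed.

(** * From the set of continuity points *)

Definition sample_set (k : nat) : args (tN ~> tN ~> tN) := (cfst k, (csnd k, tt)).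

Definition test_set (tau : nat -> nat) (n i j N : nat) : bool :=
  Qltb (cfst (tau (cpair N n))) i && Qltb j (csnd (tau (cpair N n))).

(** The test asks that the closed interval is contained in the N-th open interval of level n. Density
    is that of the continuity points, each of which is covered at every level. *)
Lemma finder_cont_set :
  finder (tN ~> tN ~> tN) cont_set irrational sample_set (fun tau => point (test_set tau) start).
Proof.
  intros A Y z HA HY [_ Hz].
  assert (A01 : forall r, A r -> I01 r) by apply HA.
  set (tau := fun k => app (tN ~> tN ~> tN) z (sample_set k)).
  assert (Ht : forall n i j N, test_set tau n i j N = true <->
            left_end (z N n) < ratR i /\ ratR j < right_end (z N n)).
  { intros n i j N. unfold test_set, tau, sample_set.
    rewrite Bool.andb_true_iff, !Qltb_spec. cbn [app fst snd]. rewrite cfst_cpair, csnd_cpair. reflexivity. }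
  apply baire_finder; fold tau.
  - intros n l r L0 L L1. destruct (off_dense A Y HY l r) as (x & Hx & NA); auto.
    assert (Hc : cont_at (spike A Y) x).
    { apply cont_at_spike; auto. split; auto. unfold I01. lra. }
    destruct (proj1 (Hz x) Hc n) as [N HN].
    destruct (rational_dense (Rmax l (left_end (z N n))) x) as [i Hi].
    { apply Rmax_lub_lt; lra. }
    destruct (rational_dense x (Rmin r (right_end (z N n)))) as [j Hj].
    { apply Rmin_glb_lt; lra. }
    pose proof (Rmax_l l (left_end (z N n))). pose proof (Rmax_r l (left_end (z N n))).
    pose proof (Rmin_l r (right_end (z N n))). pose proof (Rmin_r r (right_end (z N n))).
    exists i, j, N. rewrite Ht. lra.
  - intros x _ H. apply (cont_at_spike A Y); auto. apply Hz. intros n.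
    destruct (H n) as (i & j & N & Hi & Hx & Hj & HN). apply Ht in HN. exists N. lra.
Qed.

(** * From a modulus of continuity *)

Definition sample_mod (k : nat) : args (tR ~> tN ~> tN) := (fun _ => cfst k, (csnd k, tt)).

Definition test_mod (tau : nat -> nat) (n i j N : nat) : bool :=
  Qltb j (add_dyadic i (tau (cpair i n))).

(** The test asks that the interval is shorter than the modulus at its left end-point allows. This
    end-point is rational, hence a zero and a continuity point of F, so F is small on the interval. *)
Lemma finder_cont_modulus :
  finder (tR ~> tN ~> tN) cont_modulus irrational sample_mod
    (fun tau => point (test_mod tau) start).
Proof.
  intros A Y e HA HY (M & HM & Hmod).
  assert (A01 : forall r, A r -> I01 r) by apply HA.
  set (tau := fun k => app (tR ~> tN ~> tN) e (sample_mod k)).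
  assert (Ht : forall n i j N, test_mod tau n i j N = true <-> ratR j < ratR i + / 2 ^ M (ratR i) n).
  { intros n i j N. unfold test_mod. rewrite Qltb_spec, ratR_add_dyadic.
    unfold tau, sample_mod. cbn [app fst snd]. rewrite cfst_cpair, csnd_cpair.
    now rewrite (HM n _ _ (represents_const i)). }
  apply baire_finder; fold tau.
  - intros n l r L0 L L1. destruct (rational_dense l r L) as [i Hi].
    pose proof (inv_pow2_pos (M (ratR i) n)).
    destruct (rational_dense (ratR i) (Rmin r (ratR i + / 2 ^ M (ratR i) n))) as [j Hj].
    { apply Rmin_glb_lt; lra. }
    pose proof (Rmin_l r (ratR i + / 2 ^ M (ratR i) n)).
    pose proof (Rmin_r r (ratR i + / 2 ^ M (ratR i) n)).
    exists i, j, O. rewrite Ht. lra.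
  - intros x _ H. apply off_of_small with Y. intros n.
    destruct (H n) as (i & j & N & Hi & Hx & Hj & HN). apply Ht in HN.
    assert (NA : ~ A (ratR i)) by (intros Ai; now apply (proj2 (HA _ Ai) i)).
    assert (Hc : cont_at (spike A Y) (ratR i)).
    { apply cont_at_spike; auto. split; auto. unfold I01. lra. }
    specialize (Hmod n (ratR i) x Hc). rewrite (spike_off A Y _ NA) in Hmod.
    assert (Hd : Rabs (0 - spike A Y x) < / 2 ^ n).
    { apply Hmod; [unfold I01; lra|]. apply Rabs_def1; lra. }
    apply Rabs_def2 in Hd. pose proof (inv_pow2_pos n). lra.
Qed.

(** * From a sequence of continuous functions *)

Definition sample_approx (k : nat) : args (tR ~> tN ~> tR) :=
  (fun _ => cfst k, (cfst (csnd k), (csnd (csnd k), tt))).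

Definition test_approx (tau : nat -> nat) (n i j N : nat) : bool :=
  allb (fun k => negb ((N <=? cfst (csnd k))%nat && (Qleb i (cfst k) && Qleb (cfst k) j)) ||
    Qleb (tau k) (add_dyadic (frac 1 0 (2 ^ n - 1)) (csnd (csnd k)))).

Lemma cont_at_gt G x c : cont_at G x -> c < G x ->
  exists k, forall z, I01 z -> Rabs (z - x) < / 2 ^ k -> c < G z.
Proof.
  intros [_ H]%cont_at_iff Hc. destruct (inv_pow2_small (G x - c)) as [n Hn]; [lra|].
  destruct (H n) as [k Hk]. exists k. intros z Iz Hz. specialize (Hk z Iz Hz).
  apply Rabs_def2 in Hk. lra.
Qed.

(** The test asks that all f_m with m >= N are at most 1 / 2 ^ n at the rationals of the interval.
    By continuity the bound that is tested at rationals holds at all reals of the interval, and it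
    passes to the limit. Density is a category argument: if no subinterval of [l, r] passed, then
    the points at which f_m exceeds 1 / 2 ^ n for some m >= N would contain an open dense set for each
    N, and a common point of these sets at which F vanishes would contradict convergence. *)
Lemma finder_cont_approx :
  finder (tR ~> tN ~> tR) cont_approx irrational sample_approx
    (fun tau => point (test_approx tau) start).
Proof.
  intros A Y X HA HY (Fn & HX & Hcont & Hlim).
  assert (A01 : forall r, A r -> I01 r) by apply HA.
  set (tau := fun k => app (tR ~> tN ~> tR) X (sample_approx k)).
  assert (Htau : forall p m M, Rabs (ratR (tau (cpair p (cpair m M))) - Fn m (ratR p)) <= / 2 ^ M).
  { intros p m M. unfold tau, sample_approx. cbn [app fst snd]. rewrite !csnd_cpair, !cfst_cpair.
    apply (represents_close (X (fun _ => p) m)). apply (HX m), represents_const. }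
  assert (Ht : forall n i j N, test_approx tau n i j N = true <->
    forall m p, (N <= m)%nat -> ratR i <= ratR p <= ratR j -> Fn m (ratR p) <= / 2 ^ n).
  { intros n i j N. unfold test_approx. rewrite allb_spec. split; intros H.
    - intros m p Hm Hp. apply Rnot_lt_le. intros Hlt.
      destruct (inv_pow2_small ((Fn m (ratR p) - / 2 ^ n) / 2)) as [M HM]; [lra|].
      specialize (H (cpair p (cpair m M))). rewrite !csnd_cpair, !cfst_cpair in H.
      apply Bool.orb_true_iff in H as [H|H].
      + apply Bool.negb_true_iff, Bool.not_true_iff_false in H. apply H.
        rewrite !Bool.andb_true_iff, Nat.leb_le, !Qleb_spec. tauto.
      + apply Qleb_spec in H. rewrite ratR_add_dyadic, ratR_dyadic in H.
        specialize (Htau p m M). apply Rabs_le_between in Htau.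
        cbn [INR] in H. unfold Rdiv in H. lra.
    - intros k. apply Bool.orb_true_iff.
      destruct (_ && _)%bool eqn:E; [right|now left].
      rewrite !Bool.andb_true_iff, Nat.leb_le, !Qleb_spec in E. destruct E as [E1 E2].
      apply Qleb_spec. rewrite ratR_add_dyadic, ratR_dyadic.
      specialize (H _ _ E1 E2). specialize (Htau (cfst k) (cfst (csnd k)) (csnd (csnd k))).
      rewrite !cpair_eta in Htau. apply Rabs_le_between in Htau.
      cbn [INR]. unfold Rdiv. lra. }
  apply baire_finder; fold tau.
  - intros n l r L0 L L1. apply NNPP. intros None.
    destruct (nested_points (fun N a b =>
      (exists m, (N <= m)%nat /\ forall z, a <= z <= b -> l <= z <= r -> / 2 ^ n < Fn m z) /\
      (forall z, a <= z <= b -> spike A Y z < / 2 ^ N))) with (l := l) (r := r)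
      as (x & Hx & H); auto.
    + intros N a b a' b' [(m & Hm & H1) H2] Ha Hb. split.
      * exists m. split; auto. intros z Hz. apply H1. lra.
      * intros z Hz. apply H2. lra.
    (* Outside of [l, r] the first condition is void; there any interval will do. *)
    + intros N a0 b0 La Lab Lb.
      destruct (spike_small_interval A Y HY N a0 b0 Lab) as (a & b & Ha & Hab & Hb & Hsm).
      destruct (Rle_lt_dec b l) as [Hbl|Hbl].
      { exists a, ((a + b) / 2). repeat split; try lra.
        - exists N. split; auto. intros z Hz1 Hz2. lra.
        - intros z Hz. apply Hsm. lra. }
      destruct (Rle_lt_dec r a) as [Hra|Hra].
      { exists ((a + b) / 2), b. repeat split; try lra.
        - exists N. split; auto. intros z Hz1 Hz2. lra.
        - intros z Hz. apply Hsm. lra. }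
      destruct (rationals_between (Rmax a l) (Rmin b r)) as (i & j & Hi & Hij & Hj).
      { apply Rmax_lub_lt; apply Rmin_glb_lt; lra. }
      pose proof (Rmax_l a l). pose proof (Rmax_r a l).
      pose proof (Rmin_l b r). pose proof (Rmin_r b r).
      assert (exists m p, (N <= m)%nat /\ ratR i <= ratR p <= ratR j /\ / 2 ^ n < Fn m (ratR p))
        as (m & p & Hm & Hp & Hgt).
      { apply NNPP. intros No. apply None. exists i, j, N. repeat split; try lra.
        apply Ht. intros m p Hm Hp. apply Rnot_lt_le. intros Hlt. apply No. now exists m, p. }
      destruct (cont_at_gt (Fn m) (ratR p) (/ 2 ^ n)) as [k Hk]; auto.
      { split; [unfold I01; lra|]. apply Hcont. unfold I01. lra. }
      pose proof (inv_pow2_pos k).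
      exists (Rmax a (ratR p - / 2 ^ k / 2)), (Rmin b (ratR p + / 2 ^ k / 2)).
      pose proof (Rmax_l a (ratR p - / 2 ^ k / 2)). pose proof (Rmax_r a (ratR p - / 2 ^ k / 2)).
      pose proof (Rmin_l b (ratR p + / 2 ^ k / 2)). pose proof (Rmin_r b (ratR p + / 2 ^ k / 2)).
      repeat split; try lra.
      * apply Rmax_lub_lt; apply Rmin_glb_lt; lra.
      * exists m. split; auto. intros z Hz Hz'. apply Hk; [unfold I01; lra|].
        apply Rabs_def1; lra.
      * intros z Hz. apply Hsm. lra.
    + assert (Ix : I01 x) by (unfold I01; lra).
      assert (Hle : spike A Y x <= 0).
      { apply Rnot_lt_le. intros Hp. destruct (inv_pow2_small _ Hp) as [N HN].
        destruct (H N) as (a & b & [_ Hs] & Hab). specialize (Hs x Hab). lra. }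
      specialize (Hlim x Ix). apply is_lim_seq_spec in Hlim.
      destruct (Hlim (mkposreal _ (inv_pow2_pos n))) as [N HN].
      destruct (H N) as (a & b & [(m & Hm & Hgt) _] & Hab).
      specialize (HN m Hm). specialize (Hgt x Hab ltac:(lra)). cbn [pos] in HN.
      apply Rabs_def2 in HN. lra.
  - intros x _ H. apply off_of_small with Y. intros n.
    destruct (H n) as (i & j & N & Hi & Hx & Hj & HN). pose proof (proj1 (Ht n i j N) HN) as HN'.
    assert (Ix : I01 x) by (unfold I01; lra).
    assert (Hm : forall m, (N <= m)%nat -> Fn m x <= / 2 ^ n).
    { intros m Hm. apply Rnot_lt_le. intros Hlt.
      destruct (cont_at_gt (Fn m) x (/ 2 ^ n)) as [k Hk]; auto.
      { split; auto. now apply Hcont. }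
      pose proof (inv_pow2_pos k).
      destruct (rational_dense x (Rmin (ratR j) (x + / 2 ^ k))) as [p Hp].
      { apply Rmin_glb_lt; lra. }
      pose proof (Rmin_l (ratR j) (x + / 2 ^ k)). pose proof (Rmin_r (ratR j) (x + / 2 ^ k)).
      specialize (HN' m p Hm ltac:(lra)). specialize (Hk (ratR p)).
      assert (/ 2 ^ n < Fn m (ratR p)); [|lra].
      apply Hk; [unfold I01; lra|]. apply Rabs_def1; lra. }
    pose proof (inv_pow2_pos n). apply Rle_trans with (/ 2 ^ n); [|lra].
    assert (Hle : Rbar_le (spike A Y x) (/ 2 ^ n)); [|exact Hle].
    apply is_lim_seq_le_loc with (fun m => Fn m x) (fun _ => / 2 ^ n).
    + now exists N.
    + now apply Hlim.
    + apply is_lim_seq_const.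
Qed.

(** * Maximal labellings *)

Definition functional {X : Type} (Y : X -> nat -> Prop) : Prop :=
  forall x c c', Y x c -> Y x c' -> c = c'.

(** [Den Y c x] stands for: c denotes x, given the labelling Y. Unions of chains of admissible
    labellings are admissible because denotation is monotone. A maximal one labels every
    denoted object, as otherwise an unlabelled one could be given a code of itself as label. *)
Lemma maximal_labelling (X : Type) (Den : (X -> nat -> Prop) -> nat -> X -> Prop) :
  (forall Y Y', (forall x c, Y x c -> Y' x c) -> forall c x, Den Y c x -> Den Y' c x) ->
  (forall Y, functional Y -> forall c x x', Den Y c x -> Den Y c x' -> x = x') ->
  exists Y, functional Y /\ (forall x x' c, Y x c -> Y x' c -> x = x') /\
    (forall c x, Den Y c x -> exists c', Y x c').
Proof.
  intros mono func.
  set (graph := fun (S : (X * nat)%type -> Prop) x c => S (x, c)).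
  set (P := fun S => functional (graph S) /\ forall x c, S (x, c) -> Den (graph S) c x).
  destruct (@classical_sets.Zorn_bigcup (X * nat)%type P) as [S [[HS1 HS2] Smax]].
  - intros F HF tot. split.
    + intros x c c' [S FS Sx] [S' FS' Sx'].
      destruct (tot S S' FS FS') as [L|L]; apply L in Sx || apply L in Sx'.
      * destruct (HF S' FS') as [fS _]. exact (fS x c c' Sx Sx').
      * destruct (HF S FS) as [fS _]. exact (fS x c c' Sx Sx').
    + intros x c [S FS Sx]. destruct (HF S FS) as [_ dS].
      apply mono with (graph S); [|now apply dS].
      intros x' c' Sx'. exists S; assumption.
  - exists (graph S). split; [exact HS1|]. split.
    + intros x x' c Hx Hx'. apply (func _ HS1 c); now apply HS2.
    + intros c x Hden. apply NNPP. intros Hno.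
      set (S' := fun p => S p \/ p = (x, c)).
      assert (incl : forall x' c', graph S x' c' -> graph S' x' c') by (intros; now left).
      apply (Smax S').
      * split; [intros p Sp; now left|]. intros L. apply Hno. exists c. apply L. now right.
      * split.
        -- intros x' c1 c2 [H1|H1] [H2|H2].
           ++ exact (HS1 _ _ _ H1 H2).
           ++ injection H2 as -> ->. destruct Hno. now exists c1.
           ++ injection H1 as -> ->. destruct Hno. now exists c2.
           ++ congruence.
        -- intros x' c' [H|H].
           ++ apply mono with (graph S); auto.
           ++ injection H as -> ->. apply mono with (graph S); auto.
Qed.

(** * Kleene computations with a partial functional *)

Inductive farg := ANum (n : nat) | AFun (h : nat -> nat).

(** Argument lists of the computations in question: numbers, functions, the functional G of type 2
    and the spike function, which is given by a relation. *)
Inductive item := IArg (a : farg) | IG | IF.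

Definition num (n : nat) : item := IArg (ANum n).

Definition arg_obj (a : farg) : obj :=
  match a with ANum n => Obj tN n | AFun h => Obj tR h end.
Definition item_obj (G : sem (tR ~> tN)) (f : sem tRR) (i : item) : obj :=
  match i with IArg a => arg_obj a | IG => Obj (tR ~> tN) G | IF => Obj tRR f end.

Lemma ty_eq_dec (s t : ty) : {s = t} + {s <> t}.
Proof. decide equality. Defined.

Lemma Obj_inj t (x y : sem t) : Obj t x = Obj t y -> x = y.
Proof. apply inj_pair2_eq_dec, ty_eq_dec. Qed.

Lemma app_inj_length {X : Type} (l l' m m' : list X) :
  length l = length l' -> l ++ m = l' ++ m' -> l = l'.
Proof.
  revert l'. induction l as [|x l IH]; intros [|y l'] H E; try discriminate; auto.
  injection E as -> E. f_equal. apply IH; auto.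
Qed.

Section Partial.
Variable G : sem (tR ~> tN).

(** S1-S9 for such lists. Here [fv h m v] says that the m-th entry of the name of the value of the
    spike function at h is v; a computation that needs a value where none is given has no
    result. S8 is split according to the functional that is applied. Indices are constrained by
    equations to keep inversion from taking codes apart. The rule for S6 admits arbitrary lists of
    positions; the relation is still single-valued, and it contains the genuine computations. *)
Inductive PKleene (fv : (nat -> nat) -> nat -> nat -> Prop) : nat -> list item -> nat -> Prop :=
| PKleene1 : forall c x L, c = code [1%nat] -> PKleene fv c (num x :: L) (S x)
| PKleene2 : forall c q L, c = code [2%nat; q] -> PKleene fv c L q
| PKleene3 : forall c x L, c = code [3%nat] -> PKleene fv c (num x :: L) x
| PKleene4 : forall c e1 e2 z y L, c = code [4%nat; e1; e2] ->
    PKleene fv e2 L z -> PKleene fv e1 (num z :: L) y -> PKleene fv c L y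
| PKleene5_zero : forall c e1 e2 y L, c = code [5%nat; e1; e2] ->
    PKleene fv e1 L y -> PKleene fv c (num 0 :: L) y
| PKleene5_succ : forall c e1 e2 x z y L, c = code [5%nat; e1; e2] ->
    PKleene fv c (num x :: L) z -> PKleene fv e2 (num x :: num z :: L) y ->
    PKleene fv c (num (S x) :: L) y
| PKleene6 : forall c e1 tau y L, c = code [6%nat; e1; code tau] ->
    PKleene fv e1 (map (fun i => nth i L (num 0)) tau) y -> PKleene fv c L y
| PKleene7 : forall c f x L, c = code [7%nat] ->
    PKleene fv c (IArg (AFun f) :: num x :: L) (f x)
| PKleene8_fun : forall c d f z L, c = code [8%nat; d] ->
    PKleene fv d (IArg (AFun f) :: L) z -> PKleene fv c (IArg (AFun f) :: L) (f z)
| PKleene8_G : forall c d h L, c = code [8%nat; d] ->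
    (forall n, PKleene fv d (num n :: IG :: L) (h n)) -> PKleene fv c (IG :: L) (G h)
| PKleene8_F : forall c d1 d2 h m v L, c = code [8%nat; d1; d2] ->
    (forall n, PKleene fv d1 (num n :: IF :: L) (h n)) -> PKleene fv d2 (IF :: L) m ->
    fv h m v -> PKleene fv c (IF :: L) v
| PKleene9 : forall c d y L L', c = code [9%nat; length L] ->
    PKleene fv d L y -> PKleene fv c (num d :: L ++ L') y.

Lemma PKleene_mono fv fv' : (forall h m v, fv h m v -> fv' h m v) ->
  forall e L v, PKleene fv e L v -> PKleene fv' e L v.
Proof.
  intros H e L v K. induction K; [eapply PKleene1|eapply PKleene2|eapply PKleene3|eapply PKleene4|
    eapply PKleene5_zero|eapply PKleene5_succ|eapply PKleene6|eapply PKleene7|eapply PKleene8_fun|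
    eapply PKleene8_G|eapply PKleene8_F|eapply PKleene9]; eauto 2.
Qed.

Lemma PKleene_det fv : (forall h m v v', fv h m v -> fv h m v' -> v = v') ->
  forall e L v, PKleene fv e L v -> forall v', PKleene fv e L v' -> v = v'.
Proof.
  intros Hfv e L v K. induction K; intros v' K'; inversion K'; subst;
    repeat match goal with
    | H : code _ = code _ |- _ => apply code_inj in H; try discriminate H
    end;
    repeat match goal with
    | H : _ :: _ = _ :: _ |- _ => injection H; clear H; intros; subst
    | H : code _ = code _ |- _ => apply code_inj in H; subst
    end; auto.
  - apply IHK2. match goal with H : PKleene _ _ L ?z |- _ => now apply IHK1 in H; subst end.
  - match goal with H : PKleene _ _ (num x :: L) ?z |- _ => apply IHK1 in H; subst; auto end.
  - f_equal. auto.
  - extensionality n. auto.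
  - match goal with H : fv ?h ?m v, H' : fv ?h' ?m' v' |- _ =>
      assert (h = h') as -> by (extensionality n; auto);
      assert (m = m') as -> by auto; eauto end.
  - match goal with Ea : _ ++ _ = _ ++ _, El : length _ = length _ |- _ =>
      apply (app_inj_length _ _ _ _ (eq_sym El)) in Ea; subst end.
    auto.
Qed.

Lemma item_obj_num f i x : Obj tN x = item_obj G f i -> i = num x.
Proof.
  destruct i as [[n|h]| |]; intros E; try discriminate (f_equal (@projT1 _ _) E).
  apply Obj_inj in E. now subst.
Qed.

Lemma item_obj_fun f i h : Obj tR h = item_obj G f i -> i = IArg (AFun h).
Proof.
  destruct i as [[n|h']| |]; intros E; try discriminate (f_equal (@projT1 _ _) E).
  apply Obj_inj in E. now subst.
Qed.

(** If the partial spike function is defined at every function that is computed from good items,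
    then no genuine computation with the total function runs into a gap: in each instance of S8
    the argument is such a function by the induction hypothesis. *)
Lemma Kleene_PKleene fv f (good : item -> Prop) :
  (forall n, good (num n)) ->
  (forall d L h m, List.Forall good L -> (forall n, PKleene fv d (num n :: L) (h n)) ->
     fv h m (f h m)) ->
  forall e Lo v, Kleene e Lo v -> forall L, List.Forall good L -> Lo = map (item_obj G f) L ->
  PKleene fv e L v.
Proof.
  intros Hnum Hfv e Lo v K. induction K; intros L HL E.
  - destruct L as [|i L]; [discriminate|]. injection E as E E'.
    apply item_obj_num in E. subst. now apply PKleene1.
  - now eapply PKleene2.
  - destruct L as [|i L]; [discriminate|]. injection E as E E'.
    apply item_obj_num in E. subst. now apply PKleene3.
  - eapply PKleene4; eauto. apply IHK2; [now constructor|]. cbn. now rewrite E.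
  - destruct L as [|i L]; [discriminate|]. injection E as E E'.
    apply item_obj_num in E. subst. inversion HL; subst. eapply PKleene5_zero; eauto.
  - destruct L as [|i L]; [discriminate|]. injection E as E E'.
    apply item_obj_num in E. subst. inversion HL; subst.
    eapply PKleene5_succ; [reflexivity|apply IHK1|apply IHK2]; auto.
  - eapply PKleene6; [reflexivity|]. apply IHK.
    + apply Forall_map, Forall_forall. intros i _.
      destruct (nth_in_or_default i L (num 0)) as [Hi| ->]; auto.
      rewrite Forall_forall in HL. auto.
    + subst. rewrite map_map. apply map_ext. intros i.
      change (Obj tN O) with (item_obj G f (num 0)). apply map_nth.
  - destruct L as [|i [|j L]]; try discriminate. injection E as E E' E''.
    apply item_obj_fun in E. apply item_obj_num in E'. subst. now apply PKleene7.
  - rename H1 into sub, H2 into IH.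
    destruct L as [|i L]; [discriminate|]. injection E as E E'.
    destruct i as [[n|g]| |].
    + now pose proof (f_equal (@projT1 _ _) E).
    + pose proof (f_equal (@projT1 _ _) E) as Et; cbn in Et. subst t. apply Obj_inj in E. subst Psi.
      destruct hs as [z []]. destruct ds as [|d [|]]; try discriminate.
      eapply PKleene8_fun; [reflexivity|].
      apply (IH 0%nat (Obj tN z) eq_refl tt); auto. cbn. now rewrite E'.
    + pose proof (f_equal (@projT1 _ _) E) as Et; cbn in Et. subst t. apply Obj_inj in E. subst Psi.
      destruct hs as [h []]. destruct ds as [|d [|]]; try discriminate.
      eapply PKleene8_G; [reflexivity|]. intros n.
      apply (IH 0%nat (Obj tR h) eq_refl (n, tt)); [now constructor|]. cbn. now rewrite E'.
    + pose proof (f_equal (@projT1 _ _) E) as Et; cbn in Et. subst t. apply Obj_inj in E. subst Psi.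
      destruct hs as [h [m []]]. destruct ds as [|d1 [|d2 [|]]]; try discriminate.
      assert (Hh : forall n, PKleene fv d1 (num n :: IF :: L) (h n)).
      { intros n. apply (IH 0%nat (Obj tR h) eq_refl (n, tt)); [now constructor|].
        cbn. now rewrite E'. }
      eapply PKleene8_F with (h := h); [reflexivity|exact Hh| |].
      * apply (IH 1%nat (Obj tN m) eq_refl tt); auto. cbn. now rewrite E'.
      * cbn. eapply Hfv; [|exact Hh]. auto.
  - destruct L as [|i L]; [discriminate|]. injection E as E E'.
    apply item_obj_num in E. subst i. symmetry in E'. apply map_eq_app in E'.
    destruct E' as (L1 & L2 & -> & <- & <-). rewrite length_map.
    inversion HL; subst. match goal with H : List.Forall _ (_ ++ _) |- _ => apply Forall_app in H as [] end.
    eapply PKleene9; eauto.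
Qed.

End Partial.

(** * Spike functions with generic labels *)

(** A computation of the index [e] for some k has as inputs G, j copies of the spike function and the
    objects [fo k]. Codes are of two kinds: a list k, d, l codes the function that the index d
    computes from a number and from arguments which l describes as numbers or as inputs of the
    k-th computation; and the empty list codes [op tau], where [tau] is the sequence of all results.
    A labelling of reals by such codes, maximal in the sense of [maximal_labelling], defines A and
    Y: reals to which the computations apply the spike function have codes of the first kind, so
    that no computation breaks off, and then [op tau] has the code of the second kind. *)
Lemma generic_spikes (G : sem (tR ~> tN)) (e j : nat) (fo : nat -> list farg)
    (D : R -> Prop) (op : (nat -> nat) -> R) :
  exists (A : R -> Prop) (Y : R -> nat) (f : sem tRR),
    (forall r, A r -> I01 r /\ D r) /\ (forall r s, A r -> A s -> Y r = Y s -> r = s) /\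
    represents_fun f (spike A Y) /\
    forall tau,
      (forall k, Kleene e (Obj (tR ~> tN) G :: repeat (Obj tRR f) j ++ map arg_obj (fo k)) (tau k)) ->
      I01 (op tau) -> D (op tau) -> A (op tau).
Proof.
  set (W := fun k => IG :: repeat IF j ++ map IArg (fo k)).
  set (dec := fun k c => match cfst c with O => num (csnd c) | _ => nth (csnd c) (W k) (num 0) end).
  set (fv := fun (Y : R -> nat -> Prop) h (m v : nat) =>
    (exists r c, represents h r /\ I01 r /\ D r /\ Y r c /\ v = frac 1 0 c) \/
    (~ (exists r, represents h r /\ I01 r /\ D r) /\ v = 0%nat)).
  set (Den := fun (Y : R -> nat -> Prop) c r =>
    (exists k d l h, c = code (k :: d :: l) /\
       (forall n, PKleene G (fv Y) d (num n :: map (dec k) l) (h n)) /\ represents h r) \/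
    (exists tau, c = code [] /\ (forall k, PKleene G (fv Y) e (W k) (tau k)) /\ r = op tau)).
  assert (fv_det : forall Y, functional Y -> forall h m v v', fv Y h m v -> fv Y h m v' -> v = v').
  { intros Y HY h m v v' [(r & c & H1 & H2 & H3 & H4 & ->)|[H1 ->]]
      [(r' & c' & H1' & H2' & H3' & H4' & ->)|[H1' ->]]; auto.
    - assert (r = r') as <- by (eapply represents_unique; eauto).
      now rewrite (HY _ _ _ H4 H4').
    - destruct H1'. eauto.
    - destruct H1. eauto. }
  destruct (maximal_labelling R Den) as (Y & HY & Yinj & Ymax).
  - intros Y Y' incl c r.
    assert (Hfv : forall h m v, fv Y h m v -> fv Y' h m v).
    { intros h m v [(r' & c' & H)|H]; [left|right; auto]. exists r', c'. intuition. }
    intros [(k & d & l & h & -> & H & Hr)|(tau & -> & H & ->)].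
    + left. exists k, d, l, h. split; [|split]; auto. intros n. eapply PKleene_mono; eauto.
    + right. exists tau. split; [|split]; auto. intros k. eapply PKleene_mono; eauto.
  - intros Y HY c r r' [(k & d & l & h & -> & H & Hr)|(tau & -> & H & ->)]
      [(k' & d' & l' & h' & E & H' & Hr')|(tau' & E & H' & ->)];
      apply code_inj in E; try discriminate E.
    + injection E as <- <- <-.
      assert (h = h') as <-.
      { extensionality n. eapply PKleene_det; eauto. }
      eapply represents_unique; eauto.
    + f_equal. extensionality k. eapply PKleene_det; eauto.
  - set (A := fun r => I01 r /\ D r /\ exists c, Y r c).
    set (Y' := fun r => epsilon (inhabits 0%nat) (fun c => Y r c)).
    assert (HY' : forall r, A r -> Y r (Y' r)).
    { intros r (_ & _ & Hc). exact (epsilon_spec _ _ Hc). }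
    set (f := (fun x m => if excluded_middle_informative (exists r, represents x r /\ A r)
                    then frac 1 0 (Y' (named x)) else O) : sem tRR).
    exists A, Y', f. split; [|split; [|split]].
    + intros r (H1 & H2 & _). now split.
    + intros r s Hr Hs E. apply Yinj with (Y' r); [auto|]. rewrite E. auto.
    + intros x r Hx. unfold spike.
      assert (Hc : f x = fun _ => if excluded_middle_informative (A r) then frac 1 0 (Y' r) else O).
      { extensionality m. unfold f. rewrite (named_represents x r Hx).
        destruct excluded_middle_informative as [(s & Hs & As)|N];
          destruct excluded_middle_informative as [Ar|NA]; auto.
        - destruct NA. now rewrite (represents_unique _ _ _ Hx Hs).
        - destruct N. eauto. }
      rewrite Hc. destruct excluded_middle_informative.
      * rewrite <- ratR_spike. apply represents_const.
      * rewrite <- ratR_0. apply represents_const.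
    + intros tau Htau HI HD.
      assert (HPK : forall k, PKleene G (fv Y) e (W k) (tau k)).
      { intros k.
        apply (Kleene_PKleene G (fv Y) f (fun i => (exists n, i = num n) \/ In i (W k)))
          with (3 := Htau k).
        - eauto.
        - intros d L h m HL Hh. unfold fv, f.
          destruct (excluded_middle_informative (exists r, represents h r /\ I01 r /\ D r))
            as [(r & Hr & HIr & HDr)|N].
          + left. assert (Ar : A r).
            { split; [|split]; auto.
              assert (exists l, L = map (dec k) l) as [l ->].
              { clear Hh. induction HL as [|i L [[n ->]|Hi] HL [l ->]].
                - now exists [].
                - exists (cpair 0 n :: l). cbn [map]. f_equal. unfold dec.
                  now rewrite cfst_cpair, csnd_cpair.
                - apply (In_nth _ _ (num 0)) in Hi as (p & _ & <-).
                  exists (cpair 1 p :: l). cbn [map]. f_equal. unfold dec.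
                  now rewrite cfst_cpair, csnd_cpair. }
              apply (Ymax (code (k :: d :: l))). left. exists k, d, l, h. auto. }
            exists r, (Y' r). rewrite (named_represents h r Hr).
            destruct excluded_middle_informative as [_|N]; [|destruct N; eauto].
            repeat (split; auto).
          + right. split; auto.
            destruct excluded_middle_informative as [(r & Hr & Ar)|_]; auto.
            destruct N. exists r. unfold A in Ar. tauto.
        - apply Forall_forall. auto.
        - unfold W. cbn [map item_obj]. rewrite map_app, map_map.
          f_equal. f_equal. clear. induction j; cbn; congruence. }
      split; [|split]; auto. apply (Ymax (code [])). right. eauto.
Qed.

(** * Uniform computability *)

(** One index for all worlds w in [W]; [env w] is the argument list, which consists of the inputs of
    the functional under construction and of bound variables. A program is then a
    function of w, and binding a variable means passing from [W] to a product. *)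
Definition Comp {W : Type} (env : W -> list obj) (F : W -> nat) : Prop :=
  exists e, forall w, Kleene e (env w) (F w).

(** The indices for S6 and S9 mention the length of the argument list, so that one index can serve
    all worlds only if this length is constant. *)
Definition fixlen {W : Type} (env : W -> list obj) : Prop :=
  exists n, forall w, length (env w) = n.

Definition push {W : Type} (env : W -> list obj) : W * nat -> list obj :=
  fun p => Obj tN (snd p) :: env (fst p).

Definition pushargs {W : Type} (a : ty) (env : W -> list obj) : W * args a -> list obj :=
  fun p => objs a (snd p) ++ env (fst p).

Definition at_pos {W : Type} (env : W -> list obj) (i : nat) (t : ty) (x : W -> sem t) : Prop :=
  forall w, nth_error (env w) i = Some (Obj t (x w)).

Fixpoint arity (t : ty) : nat := match t with tN => O | _ ~> b => S (arity b) end.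

Lemma objs_length t (xs : args t) : length (objs t xs) = arity t.
Proof. induction t; cbn; auto. Qed.

Lemma fixlen_push {W} (env : W -> list obj) : fixlen env -> fixlen (push env).
Proof. intros [n H]. exists (S n). intros w. cbn. now rewrite H. Qed.

Lemma fixlen_pushargs {W} a (env : W -> list obj) : fixlen env -> fixlen (pushargs a env).
Proof.
  intros [n H]. exists (arity a + n)%nat. intros [w xs]. unfold pushargs. cbn.
  now rewrite length_app, H, objs_length.
Qed.

Lemma Comp_ext {W} (env : W -> list obj) F G : (forall w, F w = G w) -> Comp env F -> Comp env G.
Proof. intros E [e H]. exists e. intros w. rewrite <- E. apply H. Qed.

Lemma Comp_reindex {W W'} (env : W -> list obj) (env' : W' -> list obj) phi F :
  (forall w, env' w = env (phi w)) -> Comp env F -> Comp env' (fun w => F (phi w)).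
Proof. intros E [e H]. exists e. intros w. rewrite E. apply H. Qed.

(** S9 with an explicitly given index forgets the arguments after the first ones. *)
Lemma Kleene_drop e L L' v : Kleene e L v ->
  Kleene (code [4%nat; code [9%nat; length L]; code [2%nat; e]]) (L ++ L') v.
Proof. intros H. eapply S4; [apply S2|]. now apply S9. Qed.

(** S6 moves the entries that are wanted to the front, then the others are dropped. *)
Lemma Comp_rename {W W'} (env : W -> list obj) (env' : W' -> list obj) phi F sigma :
  fixlen env' -> NoDup sigma ->
  (forall w, List.Forall (fun i => (i < length (env' w))%nat) sigma) ->
  (forall w, env (phi w) = map (fun i => nth i (env' w) (Obj tN O)) sigma) ->
  Comp env F -> Comp env' (fun w => F (phi w)).
Proof.
  intros [n Hn] ND Hlt E [e H].
  set (rest := filter (fun i => negb (existsb (Nat.eqb i) sigma)) (seq 0 n)).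
  exists (code [6%nat; code [4%nat; code [9%nat; length sigma]; code [2%nat; e]];
             code (sigma ++ rest)]).
  intros w.
  assert (HP : Permutation (sigma ++ rest) (seq 0 n)).
  { assert (Hin : forall i, existsb (Nat.eqb i) sigma = true <-> In i sigma).
    { intros i. rewrite existsb_exists. split.
      - intros (x & Hx & Ex). apply Nat.eqb_eq in Ex. now subst.
      - intros Hi. exists i. split; auto. apply Nat.eqb_refl. }
    apply NoDup_Permutation.
    - apply NoDup_app; auto.
      + apply NoDup_filter, seq_NoDup.
      + intros i Hi Hr. apply filter_In in Hr as [_ Hr]. apply Hin in Hi. now rewrite Hi in Hr.
    - apply seq_NoDup.
    - intros i. rewrite in_app_iff, in_seq. unfold rest. rewrite filter_In, in_seq.
      specialize (Hlt w). rewrite List.Forall_forall in Hlt. rewrite Hn in Hlt. split.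
      + intros [Hi|Hi]; [apply Hlt in Hi; lia|tauto].
      + intros Hi. destruct (existsb (Nat.eqb i) sigma) eqn:Ex; [left; now apply Hin|right; auto]. }
  apply S6; [now rewrite Hn|]. rewrite map_app, <- E.
  replace (length sigma) with (length (env (phi w))) by now rewrite E, length_map.
  apply Kleene_drop, H.
Qed.

Lemma Comp_const {W} (env : W -> list obj) q : Comp env (fun _ => q).
Proof. eexists. intros w. apply S2. Qed.

Lemma Comp_let {W} (env : W -> list obj) F G :
  Comp env G -> Comp (push env) (fun p => F (fst p) (snd p)) -> Comp env (fun w => F w (G w)).
Proof.
  intros [e2 H2] [e1 H1]. exists (code [4%nat; e1; e2]). intros w.
  eapply S4; [apply H2|]. exact (H1 (w, G w)).
Qed.

Lemma Comp_var {W} (env : W -> list obj) i x : fixlen env -> at_pos env i tN x -> Comp env x.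
Proof.
  intros L H. apply (Comp_rename (fun z : nat => [Obj tN z]) env x (fun z => z) [i]); auto.
  - repeat constructor. intros [].
  - intros w. repeat constructor. apply nth_error_Some. now rewrite H.
  - intros w. cbn. now rewrite (nth_error_nth _ _ (Obj tN O) (H w)).
  - eexists. intros z. apply S3.
Qed.

Lemma at_pos_push {W} (env : W -> list obj) i t x :
  at_pos env i t x -> at_pos (push env) (S i) t (fun p => x (fst p)).
Proof. intros H [w z]. exact (H w). Qed.

Lemma Comp_rec {W} (env : W -> list obj) (B N : W -> nat) (Sf : W -> nat -> nat -> nat) :
  Comp env B -> Comp (push (push env)) (fun p => Sf (fst (fst p)) (snd p) (snd (fst p))) ->
  Comp env N ->
  Comp env (fun w => Nat.recursion (B w) (Sf w) (N w)).
Proof.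
  intros [b HB] [s HS] HN.
  apply (Comp_let env (fun w x => Nat.recursion (B w) (Sf w) x) N HN).
  exists (code [5%nat; b; s]). intros [w x]. unfold push. cbn [fst snd].
  induction x as [|x IH].
  - apply S5_zero, HB.
  - eapply S5_succ; [exact IH|]. exact (HS (w, _, x)).
Qed.

(** The premises of S8, with one premise for each argument, in a context with its bound variables. *)
Fixpoint Comp_args {W : Type} (env : W -> list obj) (t : ty) : (W -> args t) -> Prop :=
  match t return (W -> args t) -> Prop with
  | tN => fun _ => True
  | a ~> b => fun hs =>
      Comp (pushargs a env) (fun p => app a (fst (hs (fst p))) (snd p)) /\
      Comp_args env b (fun w => snd (hs w))
  end.

Lemma Comp_args_indices {W} (env : W -> list obj) t hs : Comp_args env t hs ->
  exists ds, forall w, length ds = length (objs t (hs w)) /\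
    forall i o, nth_error (objs t (hs w)) i = Some o -> forall xi,
      Kleene (nth i ds O) (objs (projT1 o) xi ++ env w) (app (projT1 o) (projT2 o) xi).
Proof.
  induction t as [|a _ b IH].
  - intros _. exists []. intros w. split; auto. intros [|i] o E; discriminate.
  - intros [[d H] [ds Hds]%IH]. exists (d :: ds). intros w. destruct (Hds w) as [E Hw]. split.
    + cbn. now rewrite E.
    + intros [|i] o Eo xi.
      * injection Eo as <-. exact (H (w, xi)).
      * exact (Hw i o Eo xi).
Qed.

Lemma nth_app_shift {X} (l l' : list X) i d : nth (length l + i) (l ++ l') d = nth i l' d.
Proof. induction l; auto. Qed.

Lemma map_nth_seq {X} (l : list X) d : map (fun i => nth i l d) (seq 0 (length l)) = l.
Proof.
  induction l as [|x l IH]; auto. cbn [length seq map nth]. f_equal.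
  rewrite <- seq_shift, map_map. exact IH.
Qed.

Lemma nth_map_lt {X Z} (f : X -> Z) (l : list X) i d d' :
  (i < length l)%nat -> nth i (map f l) d = f (nth i l d').
Proof. intros H. rewrite (nth_indep _ d (f d')) by now rewrite length_map. apply map_nth. Qed.

(** S8 wants the functional in front, also below the bound variables. Renaming brings it there and
    restores the original order in each of the premises. *)
Lemma Comp_app {W} (env : W -> list obj) i t (Psi : W -> sem t) (hs : W -> args t) :
  t <> tN -> fixlen env -> at_pos env i t Psi -> Comp_args env t hs ->
  Comp env (fun w => app t (Psi w) (hs w)).
Proof.
  intros Ht HL HP Hargs. destruct HL as [n Hn].
  set (sigma := i :: filter (fun j => negb (Nat.eqb i j)) (seq 0 n)).
  set (env1 := fun w => map (fun j => nth j (env w) (Obj tN O)) sigma).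
  assert (Hperm : forall j, In j sigma <-> (j < n)%nat \/ j = i).
  { intros j. unfold sigma. cbn [In]. rewrite filter_In, in_seq.
    destruct (Nat.eqb_spec i j); cbn; intuition (try lia; try discriminate). }
  assert (Hi : forall w : W, (i < n)%nat).
  { intros w. rewrite <- (Hn w). apply nth_error_Some. now rewrite HP. }
  assert (ND : NoDup sigma).
  { constructor; [|apply NoDup_filter, seq_NoDup].
    intros H. apply filter_In in H as [_ H]. now rewrite Nat.eqb_refl in H. }
  assert (L1 : forall w, length (env1 w) = length sigma) by (intros w; apply length_map).
  assert (Hrev : forall a F, Comp (pushargs a env) F -> Comp (pushargs a env1) F).
  { intros a F HF.
    set (k := arity a).
    assert (Hk : forall xi, length (objs a xi) = k) by (intros; apply objs_length).
    set (pos := fun j => epsilon (inhabits O) (fun p => (p < length sigma)%nat /\ nth p sigma O = j)).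
    assert (Hpos : forall j, (j < n)%nat -> (pos j < length sigma)%nat /\ nth (pos j) sigma O = j).
    { intros j Hj. apply epsilon_spec.
      destruct (In_nth sigma j O) as (p & Hp & E); [apply Hperm; auto|]. now exists p. }
    apply (Comp_rename (pushargs a env) (pushargs a env1) (fun w => w) F
             (seq 0 k ++ map (fun j => (k + pos j)%nat) (seq 0 n))); auto.
    - apply fixlen_pushargs. exists (length sigma). exact L1.
    - apply NoDup_app.
      + apply seq_NoDup.
      + apply NoDup_map_NoDup_ForallPairs; [|apply seq_NoDup].
        intros x y Hx Hy E. apply in_seq in Hx, Hy.
        destruct (Hpos x) as [_ E1]; [lia|]. destruct (Hpos y) as [_ E2]; [lia|].
        rewrite <- E1, <- E2. f_equal. lia.
      + intros x Hx Hm. apply in_seq in Hx. apply in_map_iff in Hm as (j & E & _). lia.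
    - intros [w xi]. unfold pushargs. cbn [fst snd]. rewrite length_app, L1, Hk.
      apply List.Forall_forall. intros x Hx. apply in_app_iff in Hx as [Hx|Hx].
      + apply in_seq in Hx. lia.
      + apply in_map_iff in Hx as (j & <- & Hj). apply in_seq in Hj.
        destruct (Hpos j); lia.
    - intros [w xi]. unfold pushargs. cbn [fst snd]. rewrite map_app, map_map. f_equal.
      + rewrite <- (map_nth_seq (objs a xi) (Obj tN O)) at 1. rewrite Hk.
        apply map_ext_in. intros j Hj. apply in_seq in Hj. rewrite app_nth1; auto. rewrite Hk. lia.
      + rewrite <- (map_nth_seq (env w) (Obj tN O)) at 1. rewrite Hn.
        apply map_ext_in. intros j Hj. apply in_seq in Hj.
        rewrite <- (Hk xi), nth_app_shift. unfold env1.
        destruct (Hpos j) as [P1 P2]; [lia|].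
        rewrite (nth_map_lt _ sigma (pos j) _ O) by auto. now rewrite P2. }
  assert (Hargs1 : Comp_args env1 t hs).
  { clear -Hargs Hrev. induction t as [|a _ b IH]; auto. destruct Hargs as [H1 H2].
    split; [now apply Hrev|now apply IH]. }
  apply Comp_args_indices in Hargs1 as [ds Hds].
  apply (Comp_rename env1 env (fun w => w) _ sigma).
  - now exists n.
  - exact ND.
  - intros w. rewrite Hn. apply List.Forall_forall. intros j Hj. apply Hperm in Hj as [Hj| ->]; auto.
  - reflexivity.
  - exists (code (8%nat :: ds)). intros w. destruct (Hds w) as [E Hw].
    assert (Ew : env1 w = Obj t (Psi w) :: tl (env1 w)).
    { unfold env1, sigma. cbn [map tl]. f_equal. now apply nth_error_nth. }
    rewrite Ew. apply S8; auto. intros j o Ho xi. rewrite <- Ew. now apply Hw.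
Qed.

Lemma Comp_weak {W} (env : W -> list obj) F :
  fixlen env -> Comp env F -> Comp (push env) (fun p => F (fst p)).
Proof.
  intros [n Hn] H. apply (Comp_rename env (push env) fst F (seq 1 n)); auto.
  - apply fixlen_push. now exists n.
  - apply seq_NoDup.
  - intros w. apply List.Forall_forall. intros i Hi. apply in_seq in Hi. cbn. rewrite Hn. lia.
  - intros [w z]. cbn [fst]. rewrite <- seq_shift, map_map. cbn.
    rewrite <- (Hn w). symmetry. apply map_nth_seq.
Qed.

Lemma Comp_weak_mid {W} (env : W -> list obj) F :
  fixlen env -> Comp (push env) (fun p => F (fst p) (snd p)) ->
  Comp (push (push env)) (fun p => F (fst (fst p)) (snd p)).
Proof.
  intros [n Hn] H.
  apply (Comp_rename (push env) (push (push env)) (fun p => (fst (fst p), snd p))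
           (fun p => F (fst p) (snd p)) (O :: seq 2 n)); auto.
  - apply fixlen_push, fixlen_push. now exists n.
  - constructor; [|apply seq_NoDup]. intros Hi. apply in_seq in Hi. lia.
  - intros w. constructor; [cbn; lia|]. apply List.Forall_forall. intros i Hi. apply in_seq in Hi.
    cbn. rewrite Hn. lia.
  - intros [[w z] x]. unfold push at 1. cbn [fst snd]. cbn [map]. f_equal.
    rewrite <- seq_shift, <- seq_shift, !map_map. cbn.
    rewrite <- (Hn w). symmetry. apply map_nth_seq.
Qed.

Lemma Comp_var0 {W} (env : W -> list obj) : fixlen env -> Comp (push env) (fun p => snd p).
Proof. intros H. apply Comp_var with O; [now apply fixlen_push|]. intros [w z]. reflexivity. Qed.

Lemma Comp_var1 {W} (env : W -> list obj) :
  fixlen env -> Comp (push (push env)) (fun p => snd (fst p)).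
Proof.
  intros H. apply Comp_var with 1%nat; [now apply fixlen_push, fixlen_push|].
  intros [[w z] z']. reflexivity.
Qed.

Lemma Comp_weak2 {W} (env : W -> list obj) F :
  fixlen env -> Comp env F -> Comp (push (push env)) (fun p => F (fst (fst p))).
Proof.
  intros L H. apply (Comp_weak (push env) (fun p => F (fst p))); [now apply fixlen_push|].
  now apply Comp_weak.
Qed.

(** * Arithmetic *)

Definition Compb {W : Type} (env : W -> list obj) (B : W -> bool) : Prop :=
  Comp env (fun w => Nat.b2n (B w)).

Create HintDb comp.
#[local] Hint Resolve fixlen_push fixlen_pushargs : comp.
#[local] Hint Resolve Comp_const Comp_var0 Comp_var1 Comp_weak Comp_weak2 : comp.

Lemma Comp_S {W} (env : W -> list obj) F :
  fixlen env -> Comp env F -> Comp env (fun w => S (F w)).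
Proof.
  intros L H. apply (Comp_let env (fun _ z => S z)); auto. eexists. intros [w z]. apply S1.
Qed.
#[local] Hint Resolve Comp_S : comp.

Ltac by_rec B Sf N :=
  apply Comp_ext with (fun w => Nat.recursion (B w) (Sf w) (N w));
  [intros w; cbv beta|apply Comp_rec; cbv beta; auto with comp].

Lemma Comp_add {W} (env : W -> list obj) F G :
  fixlen env -> Comp env F -> Comp env G -> Comp env (fun w => F w + G w)%nat.
Proof.
  intros L HF HG. by_rec F (fun (_ : W) (_ z : nat) => S z) G.
  induction (G w); cbn in *; lia.
Qed.

Lemma Comp_pred {W} (env : W -> list obj) F :
  fixlen env -> Comp env F -> Comp env (fun w => Nat.pred (F w)).
Proof.
  intros L HF. by_rec (fun _ : W => O) (fun (_ : W) (x _ : nat) => x) F.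
  now destruct (F w).
Qed.
#[local] Hint Resolve Comp_add Comp_pred : comp.

Lemma Comp_sub {W} (env : W -> list obj) F G :
  fixlen env -> Comp env F -> Comp env G -> Comp env (fun w => F w - G w)%nat.
Proof.
  intros L HF HG. by_rec F (fun (_ : W) (_ z : nat) => Nat.pred z) G.
  induction (G w); cbn in *; lia.
Qed.

Lemma Comp_mul {W} (env : W -> list obj) F G :
  fixlen env -> Comp env F -> Comp env G -> Comp env (fun w => F w * G w)%nat.
Proof.
  intros L HF HG. by_rec (fun _ : W => O) (fun (w : W) (_ z : nat) => z + F w)%nat G.
  induction (G w); cbn in *; lia.
Qed.

Lemma Comp_pow2 {W} (env : W -> list obj) F :
  fixlen env -> Comp env F -> Comp env (fun w => 2 ^ F w)%nat.
Proof.
  intros L HF. by_rec (fun _ : W => 1%nat) (fun (w : W) (_ z : nat) => z + z)%nat F.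
  induction (F w) as [|n IH]; auto. cbn in *. rewrite IH. lia.
Qed.

Lemma Comp_sumn {W} (env : W -> list obj) (F : W -> nat -> nat) G :
  fixlen env -> Comp (push env) (fun p => F (fst p) (snd p)) -> Comp env G ->
  Comp env (fun w => sumn (F w) (G w)).
Proof.
  intros L HF HG. unfold sumn.
  apply (Comp_rec env (fun _ => O) G (fun w x z => z + F w x)%nat); auto with comp.
  apply Comp_add; auto with comp. now apply Comp_weak_mid.
Qed.
#[local] Hint Resolve Comp_sub Comp_mul Comp_pow2 Comp_sumn : comp.

Lemma Compb_leb {W} (env : W -> list obj) F G :
  fixlen env -> Comp env F -> Comp env G -> Compb env (fun w => F w <=? G w)%nat.
Proof.
  intros L HF HG. apply Comp_ext with (fun w => 1 - (F w - G w))%nat; auto 6 with comp.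
  intros w. destruct (Nat.leb_spec (F w) (G w)); cbn [Nat.b2n]; lia.
Qed.

Lemma Compb_negb {W} (env : W -> list obj) A :
  fixlen env -> Compb env A -> Compb env (fun w => negb (A w)).
Proof.
  intros L H. apply Comp_ext with (fun w => 1 - Nat.b2n (A w))%nat; auto with comp.
  intros w. now destruct (A w).
Qed.

Lemma Compb_andb {W} (env : W -> list obj) A B :
  fixlen env -> Compb env A -> Compb env B -> Compb env (fun w => A w && B w)%bool.
Proof.
  intros L HA HB. apply Comp_ext with (fun w => Nat.b2n (A w) * Nat.b2n (B w))%nat; auto with comp.
  intros w. now destruct (A w), (B w).
Qed.

Lemma Comp_if {W} (env : W -> list obj) A F G :
  fixlen env -> Compb env A -> Comp env F -> Comp env G ->
  Comp env (fun w => if A w then F w else G w).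
Proof.
  intros L HA HF HG.
  apply Comp_ext with (fun w => Nat.b2n (A w) * F w + (1 - Nat.b2n (A w)) * G w)%nat.
  - intros w. destruct (A w); cbn; lia.
  - unfold Compb in *; auto 6 with comp.
Qed.
#[local] Hint Resolve Compb_leb Compb_negb Compb_andb Comp_if : comp.

Lemma Compb_orb {W} (env : W -> list obj) A B :
  fixlen env -> Compb env A -> Compb env B -> Compb env (fun w => A w || B w)%bool.
Proof.
  intros L HA HB. apply Comp_ext with (fun w => Nat.b2n (negb (negb (A w) && negb (B w)))).
  - intros w. now destruct (A w), (B w).
  - change (Compb env (fun w => negb (negb (A w) && negb (B w)))). auto with comp.
Qed.

Lemma Compb_eqb {W} (env : W -> list obj) F G :
  fixlen env -> Comp env F -> Comp env G -> Compb env (fun w => F w =? G w)%nat.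
Proof.
  intros L HF HG. apply Comp_ext with (fun w => Nat.b2n ((F w <=? G w) && (G w <=? F w))%nat).
  - intros w. destruct (Nat.eqb_spec (F w) (G w)), (Nat.leb_spec (F w) (G w)),
      (Nat.leb_spec (G w) (F w)); cbn; auto; lia.
  - change (Compb env (fun w => (F w <=? G w)%nat && (G w <=? F w)%nat)%bool). auto with comp.
Qed.

Lemma Comp_b2n {W} (env : W -> list obj) A :
  fixlen env -> Compb env A -> Comp env (fun w => Nat.b2n (A w)).
Proof. auto. Qed.

Lemma Comp_cpair {W} (env : W -> list obj) F G :
  fixlen env -> Comp env F -> Comp env G -> Comp env (fun w => cpair (F w) (G w)).
Proof.
  intros L HF HG. apply Comp_ext with (fun w => G w + sumn S (G w + F w))%nat; auto 6 with comp.
  intros w. unfold cpair, to_nat, sumn. f_equal. induction (G w + F w)%nat as [|n IH]; cbn in *; lia.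
Qed.
#[local] Hint Resolve Compb_orb Compb_eqb Comp_b2n Comp_cpair : comp.

Lemma sumn_single F n i : (i < n)%nat -> (forall j, j <> i -> F j = O) -> sumn F n = F i.
Proof.
  intros L H. unfold sumn. induction n; [lia|]. cbn.
  destruct (Nat.eq_dec i n) as [->|N].
  - enough (forall m, (m <= n)%nat -> Nat.recursion O (fun x z => z + F x)%nat m = O) as ->; auto.
    induction m; intros Hm; cbn; auto. rewrite IHm, H; lia.
  - rewrite (H n); auto. rewrite IHn; lia.
Qed.

(** Bounded sums express the projections of the pairing without recursion on pairs. *)
Lemma cfst_sum n :
  cfst n = sumn (fun x => x * sumn (fun y => Nat.b2n (cpair x y =? n)) (S n))%nat (S n).
Proof.
  rewrite (sumn_single _ _ (cfst n)).
  - rewrite (sumn_single _ _ (csnd n)).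
    + rewrite cpair_eta, Nat.eqb_refl. cbn; lia.
    + rewrite <- (cpair_eta n) at 2. pose proof (cpair_ge_r (cfst n) (csnd n)). lia.
    + intros y Hy. destruct (Nat.eqb_spec (cpair (cfst n) y) n) as [E|]; auto.
      destruct Hy. now rewrite <- E, csnd_cpair.
  - rewrite <- (cpair_eta n) at 2. pose proof (cpair_ge_l (cfst n) (csnd n)). lia.
  - intros x Hx.
    assert (Z : forall y, Nat.b2n (cpair x y =? n)%nat = O).
    { intros y. destruct (Nat.eqb_spec (cpair x y) n) as [E|]; auto.
      destruct Hx. now rewrite <- E, cfst_cpair. }
    rewrite (sumn_single _ _ O), Z; auto with arith.
Qed.

Lemma csnd_sum n :
  csnd n = sumn (fun y => y * Nat.b2n (cpair (cfst n) y =? n))%nat (S n).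
Proof.
  rewrite (sumn_single _ _ (csnd n)).
  - rewrite cpair_eta, Nat.eqb_refl. cbn; lia.
  - rewrite <- (cpair_eta n) at 2. pose proof (cpair_ge_r (cfst n) (csnd n)). lia.
  - intros y Hy. destruct (Nat.eqb_spec (cpair (cfst n) y) n) as [E|]; [|cbn; lia].
    destruct Hy. now rewrite <- E, csnd_cpair.
Qed.

Lemma Comp_cfst {W} (env : W -> list obj) F :
  fixlen env -> Comp env F -> Comp env (fun w => cfst (F w)).
Proof.
  intros L HF. eapply Comp_ext; [intros w; symmetry; apply cfst_sum|].
  apply Comp_sumn; auto with comp. apply Comp_mul; auto with comp.
  apply (Comp_sumn (push env)
    (fun p y => Nat.b2n (cpair (snd p) y =? F (fst p))%nat)); auto 8 with comp.
Qed.

Lemma Comp_csnd {W} (env : W -> list obj) F :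
  fixlen env -> Comp env F -> Comp env (fun w => csnd (F w)).
Proof.
  intros L HF. eapply Comp_ext; [intros w; symmetry; apply csnd_sum|].
  pose proof (Comp_cfst env F L HF).
  apply Comp_sumn; auto with comp. apply Comp_mul; auto with comp.
  apply Comp_b2n, Compb_eqb; auto with comp. apply Comp_cpair; auto with comp.
  now apply (Comp_weak env (fun w => cfst (F w))).
Qed.

Lemma Comp_frac {W} (env : W -> list obj) F G H :
  fixlen env -> Comp env F -> Comp env G -> Comp env H ->
  Comp env (fun w => frac (F w) (G w) (H w)).
Proof. intros. unfold frac. auto with comp. Qed.
#[local] Hint Resolve Comp_cfst Comp_csnd Comp_frac : comp.

Lemma Compb_Qleb {W} (env : W -> list obj) F G :
  fixlen env -> Comp env F -> Comp env G -> Compb env (fun w => Qleb (F w) (G w)).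
Proof. intros. unfold Qleb. auto 10 with comp. Qed.

Lemma Compb_Qltb {W} (env : W -> list obj) F G :
  fixlen env -> Comp env F -> Comp env G -> Compb env (fun w => Qltb (F w) (G w)).
Proof. intros. apply Compb_negb; auto. now apply Compb_Qleb. Qed.

Lemma Comp_add_dyadic {W} (env : W -> list obj) F G :
  fixlen env -> Comp env F -> Comp env G -> Comp env (fun w => add_dyadic (F w) (G w)).
Proof. intros. unfold add_dyadic. auto 10 with comp. Qed.
#[local] Hint Resolve Compb_Qleb Compb_Qltb Comp_add_dyadic : comp.

(** * Contexts with added bound variables *)

(** [env] adds bound variables in front of [base]; what is available in [base] remains so. *)
Definition extends {W W0 : Type} (env : W -> list obj) (phi : W -> W0)
    (base : W0 -> list obj) : Prop :=
  fixlen env /\ exists k, forall w, skipn k (env w) = base (phi w).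

Lemma extends_fixlen {W W0} (env : W -> list obj) phi (base : W0 -> list obj) :
  extends env phi base -> fixlen env.
Proof. now intros [H _]. Qed.

Lemma extends_refl {W} (env : W -> list obj) : fixlen env -> extends env (fun w => w) env.
Proof. intros H. split; auto. now exists O. Qed.

Lemma extends_push {W W0} (env : W -> list obj) phi (base : W0 -> list obj) :
  extends env phi base -> extends (push env) (fun p => phi (fst p)) base.
Proof.
  intros [H [k E]]. split; [now apply fixlen_push|]. exists (S k). intros [w z]. apply E.
Qed.

Lemma extends_pushargs {W W0} a (env : W -> list obj) phi (base : W0 -> list obj) :
  extends env phi base -> extends (pushargs a env) (fun p => phi (fst p)) base.
Proof.
  intros [H [k E]]. split; [now apply fixlen_pushargs|]. exists (arity a + k)%nat.
  intros [w xs]. unfold pushargs. cbn [fst snd].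
  rewrite skipn_app, objs_length, skipn_all2 by (rewrite objs_length; lia).
  replace (arity a + k - arity a)%nat with k by lia. apply E.
Qed.

Lemma extends_at {W W0} (env : W -> list obj) phi (base : W0 -> list obj) i t x :
  extends env phi base -> at_pos base i t x -> exists i', at_pos env i' t (fun w => x (phi w)).
Proof.
  intros [_ [k E]] H. exists (k + i)%nat. intros w. rewrite <- (H (phi w)), <- E.
  symmetry. apply nth_error_skipn.
Qed.

#[local] Hint Resolve extends_fixlen extends_push extends_pushargs : comp.

Lemma Comp_function {W} (env : W -> list obj) i (x : W -> sem tR) N :
  fixlen env -> at_pos env i tR x -> Comp env N -> Comp env (fun w => x w (N w)).
Proof.
  intros L H HN.
  apply (Comp_app env i tR x (fun w => (N w, tt))); auto; [discriminate|]. cbn. split; auto.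
  now apply (Comp_reindex env (pushargs tN env) fst N).
Qed.

Lemma Comp_functional {W} (env : W -> list obj) i (G : W -> sem (tR ~> tN)) (F : W -> nat -> nat) :
  fixlen env -> at_pos env i (tR ~> tN) G -> Comp (push env) (fun p => F (fst p) (snd p)) ->
  Comp env (fun w => G w (F w)).
Proof.
  intros L H HF.
  apply (Comp_app env i (tR ~> tN) G (fun w => (F w, tt))); auto; [discriminate|]. cbn. split; auto.
  now apply (Comp_reindex (push env) (pushargs tR env) (fun p => (fst p, fst (snd p)))
    (fun p => F (fst p) (snd p))).
Qed.

Lemma Compb_allb {W} (env : W -> list obj) i (P : W -> nat -> bool) :
  fixlen env -> at_pos env i (tR ~> tN) (fun _ => E2) ->
  Compb (push env) (fun p => P (fst p) (snd p)) -> Compb env (fun w => allb (P w)).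
Proof.
  intros L H HP. unfold allb. apply Compb_negb; auto. apply Compb_eqb; auto with comp.
  now apply (Comp_functional env i (fun _ => E2) (fun w k => Nat.b2n (P w k))).
Qed.

Lemma Compb_exb {W} (env : W -> list obj) i (P : W -> nat -> bool) :
  fixlen env -> at_pos env i (tR ~> tN) (fun _ => E2) ->
  Compb (push env) (fun p => P (fst p) (snd p)) -> Compb env (fun w => exb (P w)).
Proof.
  intros L H HP. unfold exb. apply Compb_negb; auto. apply Compb_allb with i; auto.
  apply Compb_negb; auto with comp.
Qed.

(** * The Baire process is computable in E2 *)

Section Programs.
Context {W0 : Type} (base : W0 -> list obj) (iE : nat).
Hypothesis HE : at_pos base iE (tR ~> tN) (fun _ => E2).

(** Stability under further bound variables is built in, as these programs are used below binders. *)
Definition effective1 (tau : W0 -> nat -> nat) : Prop :=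
  forall W (env : W -> list obj) phi, extends env phi base ->
  forall N, Comp env N -> Comp env (fun w => tau (phi w) (N w)).

Definition effective_test (tst : W0 -> nat -> nat -> nat -> nat -> bool) : Prop :=
  forall W (env : W -> list obj) phi, extends env phi base ->
  forall n i j N, Comp env n -> Comp env i -> Comp env j -> Comp env N ->
    Compb env (fun w => tst (phi w) (n w) (i w) (j w) (N w)).

Lemma effective_point tst s0 : effective_test tst ->
  effective1 (fun w => point (tst w) s0).
Proof.
  intros Htst.
  assert (Hacc : forall W (env : W -> list obj) phi, extends env phi base ->
    forall s m, Comp env s -> Comp env m -> Compb env (fun w => accept (tst (phi w)) (s w) (m w))).
  { intros W env phi X s m Hs Hm. pose proof (extends_fixlen _ _ _ X) as L.
    assert (Compb env (fun w => tst (phi w) (cfst (s w)) (lo (m w)) (hi (m w)) (wit (m w)))).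
    { apply Htst; unfold lo, hi, wit; auto with comp. }
    unfold accept, lo, hi, wit in *. auto 12 with comp. }
  assert (Hstage : forall W (env : W -> list obj) phi, extends env phi base ->
    forall t, Comp env t -> Comp env (fun w => stage (tst (phi w)) s0 (t w))).
  { intros W env phi X t Ht. pose proof (extends_fixlen _ _ _ X) as L.
    apply (Comp_rec env (fun _ => s0) t
      (fun w x s => if accept (tst (phi w)) s (cfst x) then cfst x else s)); auto with comp.
    apply Comp_if; auto with comp.
    apply (Hacc _ _ (fun p => phi (fst (fst p)))); auto with comp.
    now apply (extends_push (push env) (fun p => phi (fst p))), extends_push. }
  intros W env phi X N HN. pose proof (extends_fixlen _ _ _ X) as L.
  unfold point, digits. apply Comp_frac; auto with comp.
  apply (Comp_sumn env (fun w i => Nat.b2n (exb (fun t =>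
    Qleb (frac (S i) 0 (2 ^ N w - 1)) (lo (stage (tst (phi w)) s0 t)))))); auto with comp.
  pose proof (extends_push _ _ _ X) as X1. pose proof (extends_push _ _ _ X1) as X2.
  destruct (extends_at _ _ _ _ _ _ X1 HE) as [i Hi].
  apply (Compb_exb (push env) i (fun p t =>
    Qleb (frac (S (snd p)) 0 (2 ^ N (fst p) - 1)) (lo (stage (tst (phi (fst p))) s0 t))));
    auto with comp.
  assert (Comp (push (push env))
    (fun p => stage (tst (phi (fst (fst p)))) s0 (snd p))).
  { apply (Hstage _ _ (fun p => phi (fst (fst p)))); auto with comp. }
  unfold lo. auto 12 with comp.
Qed.

Lemma effective_test_sup tau : effective1 tau -> effective_test (fun w => test_sup (tau w)).
Proof.
  intros Ht W env phi X n i j N Hn Hi Hj HN. pose proof (extends_fixlen _ _ _ X) as L.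
  assert (Comp env (fun w => tau (phi w) (cpair (i w) (cpair (j w) (n w))))).
  { apply (Ht W env phi X (fun w => cpair (i w) (cpair (j w) (n w)))); auto with comp. }
  unfold test_sup. auto 12 with comp.
Qed.

Lemma effective_test_set tau : effective1 tau -> effective_test (fun w => test_set (tau w)).
Proof.
  intros Ht W env phi X n i j N Hn Hi Hj HN. pose proof (extends_fixlen _ _ _ X) as L.
  assert (Comp env (fun w => tau (phi w) (cpair (N w) (n w)))).
  { apply (Ht W env phi X (fun w => cpair (N w) (n w))); auto with comp. }
  unfold test_set. auto 12 with comp.
Qed.

Lemma effective_test_mod tau : effective1 tau -> effective_test (fun w => test_mod (tau w)).
Proof.
  intros Ht W env phi X n i j N Hn Hi Hj HN. pose proof (extends_fixlen _ _ _ X) as L.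
  assert (Comp env (fun w => tau (phi w) (cpair (i w) (n w)))).
  { apply (Ht W env phi X (fun w => cpair (i w) (n w))); auto with comp. }
  unfold test_mod. auto 12 with comp.
Qed.

Lemma effective_test_approx tau : effective1 tau -> effective_test (fun w => test_approx (tau w)).
Proof.
  intros Ht W env phi X n i j N Hn Hi Hj HN. pose proof (extends_fixlen _ _ _ X) as L.
  destruct (extends_at _ _ _ _ _ _ X HE) as [e He].
  apply (Compb_allb env e (fun w k =>
    negb ((N w <=? cfst (csnd k))%nat && (Qleb (i w) (cfst k) && Qleb (cfst k) (j w))) ||
    Qleb (tau (phi w) k) (add_dyadic (frac 1 0 (2 ^ n w - 1)) (csnd (csnd k))))%bool); auto.
  assert (Comp (push env) (fun p => tau (phi (fst p)) (snd p))).
  { apply (Ht _ _ (fun p => phi (fst p))); auto with comp. }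
  auto 12 with comp.
Qed.
End Programs.

(** * One or two copies of the input function *)

Fixpoint inputs (j : nat) (t : ty) : ty :=
  match j with O => t | S j => tRR ~> inputs j t end.

Fixpoint supply (j : nat) (t : ty) : sem (inputs j t) -> sem tRR -> sem t :=
  match j return sem (inputs j t) -> sem tRR -> sem t with
  | O => fun Phi _ => Phi
  | S j => fun Phi f => supply j t (Phi f) f
  end.

Fixpoint feed (j : nat) (t : ty) (f : sem tRR) (xs : args t) : args (inputs j t) :=
  match j return args (inputs j t) with
  | O => xs
  | S j => (f, feed j t f xs)
  end.

Lemma app_feed j t Phi f xs : app (inputs j t) Phi (feed j t f xs) = app t (supply j t Phi f) xs.
Proof. revert Phi. induction j; intros Phi; cbn; auto. Qed.

Lemma objs_feed j t f xs : objs (inputs j t) (feed j t f xs) = repeat (Obj tRR f) j ++ objs t xs.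
Proof. induction j; cbn; congruence. Qed.

(** The common part of the two kinds of problems: j copies of a representative of the spike function
    are a correct input for j = 1, and for j = 2 as the function is its own oscillation. *)
Definition solves_spikes (j : nat) (t : ty) (P : (R -> R) -> sem t -> Prop)
    (Phi : sem (inputs j t)) : Prop :=
  forall A Y f, (forall r, A r -> I01 r) -> (forall r s, A r -> A s -> Y r = Y s -> r = s) ->
    represents_fun f (spike A Y) -> P (spike A Y) (supply j t Phi f).

Lemma solves_solves_spikes t P Phi : solves t P Phi -> solves_spikes 1 t P Phi.
Proof.
  intros H A Y f A01 Yinj Hf. apply H; auto.
  - now apply usco_spike.
  - intros x _. apply spike_range.
Qed.

Lemma solves_with_osc_solves_spikes t P Phi : solves_with_osc t P Phi -> solves_spikes 2 t P Phi.
Proof.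
  intros H A Y f A01 Yinj Hf. apply (H (spike A Y) f (spike A Y) f); auto.
  - now apply usco_spike.
  - intros x _. apply spike_range.
  - intros x Ix. now rewrite osc_spike.
Qed.

(** * No solution is computable in a functional of type 2 *)

(** With generic labels the real that is found is denoted by a code and thus lies in [A]. *)
Lemma not_computable_in_type2 (G : sem (tR ~> tN)) j t P D sample name (fo : nat -> list farg)
    (Phi : sem (inputs j t)) :
  finder t P D sample name -> (forall k, objs t (sample k) = map arg_obj (fo k)) ->
  solves_spikes j t P Phi -> ~ computable_in [Obj (tR ~> tN) G] (inputs j t) Phi.
Proof.
  intros Hfind Hfo HPhi [e He].
  destruct (generic_spikes G e j fo D (fun tau => named (name tau))) as (A & Y & f & HA & HY & Hf & H).
  assert (A01 : forall r, A r -> I01 r) by apply HA.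
  destruct (Hfind A Y (supply j t Phi f)) as (x & Hx & Ix & Dx & NA); auto.
  apply NA. rewrite <- (named_represents _ _ Hx) in *. apply H; auto.
  intros k. rewrite <- Hfo, <- app_feed, <- objs_feed. apply He.
Qed.

(** * Computing a Cantor realiser *)

Definition realiser_type : ty := (tR ~> tN) ~> (tR ~> tN) ~> tR.

Definition context {u : ty} (Phi : sem u) (w : args realiser_type) : list obj :=
  Obj u Phi :: Obj (tR ~> tN) E2 :: objs realiser_type w.

Lemma fixlen_context {u} (Phi : sem u) : fixlen (context Phi).
Proof. exists 5%nat. intros (a & y & n & []). reflexivity. Qed.

Definition spike_fun (mem : sem (tR ~> tN) -> sem tR -> bool) (a y : sem (tR ~> tN)) : sem tRR :=
  fun x _ => if mem a x then frac 1 0 (y x) else O.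

Definition decides (mem : sem (tR ~> tN) -> sem tR -> bool) (D : R -> Prop) : Prop :=
  forall a A x r, represents_set a A -> represents x r -> (mem a x = true <-> A r /\ D r).

Lemma represents_spike_fun mem D a y A Y : decides mem D ->
  represents_set a A -> represents_nat_fun y Y ->
  represents_fun (spike_fun mem a y) (spike (fun r => A r /\ D r) Y).
Proof.
  intros Hmem Ha Hy x r Hx. pose proof (Hmem a A x r Ha Hx) as Hm.
  unfold spike_fun, spike. rewrite (Hy x r Hx).
  destruct excluded_middle_informative as [H|H].
  - apply Hm in H. rewrite H, <- ratR_spike. apply represents_const.
  - destruct (mem a x); [destruct H; now apply Hm|]. rewrite <- ratR_0. apply represents_const.
Qed.

Definition effective_mem (mem : sem (tR ~> tN) -> sem tR -> bool) : Prop :=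
  forall W (env : W -> list obj) i j k (a : W -> sem (tR ~> tN)) (x : W -> sem tR), fixlen env ->
    at_pos env i (tR ~> tN) (fun _ => E2) -> at_pos env j (tR ~> tN) a -> at_pos env k tR x ->
    Compb env (fun w => mem (a w) (x w)).

Definition effective_sample (t : ty) (sample : nat -> args t) : Prop :=
  forall W (env : W -> list obj) K, fixlen env -> Comp env K -> Comp_args env t (fun w => sample (K w)).

Definition effective_name (name : (nat -> nat) -> nat -> nat) : Prop :=
  forall W0 (base : W0 -> list obj) i tau, at_pos base i (tR ~> tN) (fun _ => E2) ->
    effective1 base tau -> effective1 base (fun w => name (tau w)).

Lemma Comp_apply {W} (env : W -> list obj) i j (G : W -> sem (tR ~> tN)) (x : W -> sem tR) :
  fixlen env -> at_pos env i (tR ~> tN) G -> at_pos env j tR x -> Comp env (fun w => G w (x w)).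
Proof.
  intros L HG Hx. apply (Comp_functional env i G x); auto.
  apply (Comp_function (push env) (S j) (fun p => x (fst p)) (fun p => snd p)); auto with comp.
  now apply at_pos_push.
Qed.

(** The solution is applied, by S8, to the spike function of the restricted set, which is
    computable in [a], [y] and E2, and to the arguments of the sample; [name] does the rest. The real
    that is found satisfies [D], so it is off [A] if it is off the restriction of [A] to [D]. *)
Lemma computes_realiser j t P D sample name mem (Phi : sem (inputs j t)) :
  inputs j t <> tN ->
  finder t P D sample name -> decides mem D ->
  effective_mem mem -> effective_sample t sample -> effective_name name ->
  solves_spikes j t P Phi ->
  exists Theta, Cantor_realiser Theta /\
    computable_in [Obj (inputs j t) Phi; Obj (tR ~> tN) E2] realiser_type Theta.
Proof.
  intros Hj Hfind Hmem Emem Esample Ename HPhi.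
  set (tau := fun (a y : sem (tR ~> tN)) k => app t (supply j t Phi (spike_fun mem a y)) (sample k)).
  exists (fun a y => name (tau a y)). split.
  - intros a A y Y Ha Hy A01 _ Yinj.
    destruct (Hfind (fun r => A r /\ D r) Y (supply j t Phi (spike_fun mem a y)))
      as (x & Hx & Ix & Dx & NA).
    + intros r [Ar Dr]. split; auto.
    + intros r s [Ar _] [As _]. auto.
    + apply HPhi.
      * intros r [Ar _]. auto.
      * intros r s [Ar _] [As _]. auto.
      * now apply represents_spike_fun.
    + exists x. split; [exact Hx|]. tauto.
  - set (base := context Phi).
    assert (L : fixlen base) by apply fixlen_context.
    assert (HE : at_pos base 1 (tR ~> tN) (fun _ => E2)) by (intros w; reflexivity).
    assert (HP : at_pos base 0 (inputs j t) (fun _ => Phi)) by (intros w; reflexivity).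
    assert (Ha : at_pos base 2 (tR ~> tN) (fun w => fst w)) by (intros w; reflexivity).
    assert (Hy : at_pos base 3 (tR ~> tN) (fun w => fst (snd w))) by (intros w; reflexivity).
    assert (Hn : at_pos base 4 tN (fun w => fst (snd (snd w)))) by (intros w; reflexivity).
    assert (Htau : effective1 base (fun w => tau (fst w) (fst (snd w)))).
    { intros W env phi X K HK. pose proof (extends_fixlen _ _ _ X) as LE.
      destruct (extends_at _ _ _ _ _ _ X HP) as [p Hp].
      apply Comp_ext with (fun w => app (inputs j t) Phi
        (feed j t (spike_fun mem (fst (phi w)) (fst (snd (phi w)))) (sample (K w)))).
      { intros w. apply app_feed. }
      apply (Comp_app env p (inputs j t) (fun _ => Phi) (fun w =>
        feed j t (spike_fun mem (fst (phi w)) (fst (snd (phi w)))) (sample (K w)))); auto.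
      assert (Hf : Comp (pushargs tRR env)
        (fun q => spike_fun mem (fst (phi (fst q))) (fst (snd (phi (fst q))))
                    (fst (snd q)) (fst (snd (snd q))))).
      { pose proof (extends_pushargs tRR _ _ _ X) as X'.
        pose proof (extends_fixlen _ _ _ X') as LX.
        destruct (extends_at _ _ _ _ _ _ X' HE) as [iE HE'].
        destruct (extends_at _ _ _ _ _ _ X' Ha) as [ia Ha'].
        destruct (extends_at _ _ _ _ _ _ X' Hy) as [iy Hy'].
        assert (Hx : at_pos (pushargs tRR env) 0 tR (fun q => fst (snd q))).
        { intros (w & x & m & []). reflexivity. }
        unfold spike_fun. apply Comp_if; auto with comp.
        - eapply Emem; eauto.
        - apply Comp_frac; auto with comp. eapply Comp_apply; eauto. }
      assert (Hs : Comp_args env t (fun w => sample (K w))) by now apply Esample.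
      clear - Hf Hs. induction j as [|j IH]; auto. split; [exact Hf|exact IH]. }
    destruct (Ename _ base 1%nat _ HE Htau _ base (fun w => w) (extends_refl base L)
      (fun w => fst (snd (snd w)))) as [e He].
    { now apply Comp_var with 4%nat. }
    exists e. intros w. exact (He w).
Qed.

(** * Membership tests *)

Definition mem_all (a : sem (tR ~> tN)) (x : sem tR) : bool := negb (a x =? 0)%nat.

(** Equality with a given rational is a universal statement about the approximations, so nested uses
    of E2 decide rationality. *)
Definition rational_name (x : sem tR) : bool :=
  exb (fun i => allb (fun n => Qleb (x n) (add_dyadic i n) && Qleb i (add_dyadic (x n) n))).

Definition mem_irrational (a : sem (tR ~> tN)) (x : sem tR) : bool :=
  mem_all a x && negb (rational_name x).

Lemma decides_mem_all : decides mem_all (fun _ => True).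
Proof.
  intros a A x r Ha Hx. destruct (Ha x r Hx) as [H1 H2]. unfold mem_all.
  destruct (classic (A r)) as [Ar|NA].
  - rewrite H1 by auto. cbn. tauto.
  - rewrite H2 by auto. cbn. split; [discriminate|tauto].
Qed.

Lemma rational_name_spec x r : represents x r ->
  (rational_name x = true <-> exists i, r = ratR i).
Proof.
  intros Hx. unfold rational_name. rewrite exb_spec. split; intros [i Hi]; exists i.
  - rewrite allb_spec in Hi. apply Rminus_diag_uniq, NNPP. intros N.
    pose proof (Rabs_pos_lt _ N) as Hp.
    destruct (inv_pow2_small (Rabs (r - ratR i) / 2)) as [n Hn]; [lra|].
    specialize (Hi n). rewrite Bool.andb_true_iff, !Qleb_spec, !ratR_add_dyadic in Hi.
    pose proof (represents_close x r n Hx) as Hc. apply Rabs_le_between in Hc.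
    assert (Rabs (r - ratR i) <= 2 * / 2 ^ n) by (apply Rabs_le; lra). lra.
  - apply allb_spec. intros n. rewrite Bool.andb_true_iff, !Qleb_spec, !ratR_add_dyadic.
    pose proof (represents_close x r n Hx) as Hc. apply Rabs_le_between in Hc. lra.
Qed.

Lemma decides_mem_irrational : decides mem_irrational irrational.
Proof.
  intros a A x r Ha Hx. unfold mem_irrational.
  rewrite Bool.andb_true_iff, Bool.negb_true_iff, <- Bool.not_true_iff_false,
    (rational_name_spec x r Hx), (decides_mem_all a A x r Ha Hx). unfold irrational.
  split; intros [H1 H2]; split; try tauto.
  - intros i E. apply H2. now exists i.
  - intros [i E]. now apply (H2 i).
Qed.

Lemma effective_mem_all : effective_mem mem_all.
Proof.
  intros W env i j k a x L _ Ha Hx. pose proof (Comp_apply env j k a x L Ha Hx).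
  unfold mem_all. auto with comp.
Qed.

Lemma effective_mem_irrational : effective_mem mem_irrational.
Proof.
  intros W env i j k a x L HE Ha Hx. unfold mem_irrational.
  pose proof (effective_mem_all W env i j k a x L HE Ha Hx).
  apply Compb_andb; auto. apply Compb_negb; auto.
  apply (Compb_exb env i (fun w i => allb (fun n =>
    Qleb (x w n) (add_dyadic i n) && Qleb i (add_dyadic (x w n) n)))); auto.
  apply (Compb_allb (push env) (S i) (fun p n =>
    Qleb (x (fst p) n) (add_dyadic (snd p) n) && Qleb (snd p) (add_dyadic (x (fst p) n) n))%bool);
    auto with comp.
  { now apply (at_pos_push env i (tR ~> tN) (fun _ => E2)). }
  assert (Comp (push (push env)) (fun p => x (fst (fst p)) (snd p))).
  { apply (Comp_function (push (push env)) (S (S k)) (fun p => x (fst (fst p)))); auto with comp.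
    now apply (at_pos_push (push env) (S k) tR (fun p => x (fst p))), at_pos_push. }
  auto 12 with comp.
Qed.

(** * Samples *)

Lemma Comp_args_number {W} (env : W -> list obj) F :
  Comp env F -> Comp (pushargs tN env) (fun p => F (fst p)).
Proof. intros H. now apply (Comp_reindex env (pushargs tN env) fst F). Qed.

Lemma Comp_args_constant {W} (env : W -> list obj) F :
  fixlen env -> Comp env F -> Comp (pushargs tR env) (fun p => F (fst p)).
Proof.
  intros L H. now apply (Comp_reindex (push env) (pushargs tR env) (fun p => (fst p, fst (snd p)))
    (fun p => F (fst p))), Comp_weak.
Qed.

Lemma effective_sample_point : effective_sample tR (fun k => (k, tt)).
Proof. intros W env K L HK. split; [|exact I]. now apply (Comp_args_number env K). Qed.

Lemma effective_sample_sup : effective_sample _ sample_sup.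
Proof.
  intros W env K L HK. repeat split.
  - apply (Comp_args_constant env (fun w => cfst (K w))); auto with comp.
  - apply (Comp_args_constant env (fun w => cfst (csnd (K w)))); auto with comp.
  - apply (Comp_args_number env (fun w => csnd (csnd (K w)))); auto with comp.
Qed.

Lemma effective_sample_set : effective_sample _ sample_set.
Proof.
  intros W env K L HK. repeat split.
  - apply (Comp_args_number env (fun w => cfst (K w))); auto with comp.
  - apply (Comp_args_number env (fun w => csnd (K w))); auto with comp.
Qed.

Lemma effective_sample_mod : effective_sample _ sample_mod.
Proof.
  intros W env K L HK. repeat split.
  - apply (Comp_args_constant env (fun w => cfst (K w))); auto with comp.
  - apply (Comp_args_number env (fun w => csnd (K w))); auto with comp.
Qed.

Lemma effective_sample_approx : effective_sample _ sample_approx.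
Proof.
  intros W env K L HK. repeat split.
  - apply (Comp_args_constant env (fun w => cfst (K w))); auto with comp.
  - apply (Comp_args_number env (fun w => cfst (csnd (K w)))); auto with comp.
  - apply (Comp_args_number env (fun w => csnd (csnd (K w)))); auto with comp.
Qed.

Definition first_order (t : ty) (sample : nat -> args t) : Prop :=
  exists fo : nat -> list farg, forall k, objs t (sample k) = map arg_obj (fo k).

Lemma first_order_point : first_order tR (fun k => (k, tt)).
Proof. now exists (fun k => [ANum k]). Qed.

Lemma first_order_sup : first_order _ sample_sup.
Proof.
  now exists (fun k => [AFun (fun _ => cfst k); AFun (fun _ => cfst (csnd k)); ANum (csnd (csnd k))]).
Qed.

Lemma first_order_set : first_order _ sample_set.
Proof. now exists (fun k => [ANum (cfst k); ANum (csnd k)]). Qed.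

Lemma first_order_mod : first_order _ sample_mod.
Proof.
  now exists (fun k => [AFun (fun _ => cfst k); ANum (csnd k)]).
Qed.

Lemma first_order_approx : first_order _ sample_approx.
Proof.
  now exists (fun k => [AFun (fun _ => cfst k); ANum (cfst (csnd k)); ANum (csnd (csnd k))]).
Qed.

Lemma effective_name_id : effective_name (fun tau => tau).
Proof. intros W0 base i tau _ H. exact H. Qed.

Lemma effective_name_point (test : (nat -> nat) -> nat -> nat -> nat -> nat -> bool) :
  (forall W0 (base : W0 -> list obj) i tau, at_pos base i (tR ~> tN) (fun _ => E2) ->
     effective1 base tau -> effective_test base (fun w => test (tau w))) ->
  effective_name (fun tau => point (test tau) start).
Proof.
  intros H W0 base i tau HE Ht. apply (effective_point base i HE (fun w => test (tau w))).
  now apply H with i.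
Qed.

(** The conclusions for both kinds of problems; the second part asks for at least one copy of the
    input, without which there would be no functional to apply. *)
Definition hard (t : ty) (P : (R -> R) -> sem t -> Prop) : Prop :=
  (forall G j (Phi : sem (inputs j t)), solves_spikes j t P Phi ->
     ~ computable_in [Obj (tR ~> tN) G] (inputs j t) Phi) /\
  (forall j (Phi : sem (inputs (S j) t)), solves_spikes (S j) t P Phi ->
     exists Theta, Cantor_realiser Theta /\
       computable_in [Obj (inputs (S j) t) Phi; Obj (tR ~> tN) E2] realiser_type Theta).

Lemma hard_of_finder t P D sample name mem :
  finder t P D sample name -> first_order t sample -> decides mem D ->
  effective_mem mem -> effective_sample t sample -> effective_name name -> hard t P.
Proof.
  intros Hf [fo Hfo] Hd Em Es En. split.
  - intros G j Phi. now apply not_computable_in_type2 with D sample name fo.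
  - intros j Phi. now apply computes_realiser with D sample name mem.
Qed.

Lemma hard_cont_point : hard _ cont_point.
Proof.
  exact (hard_of_finder _ _ _ _ _ _ finder_cont_point first_order_point decides_mem_all
    effective_mem_all effective_sample_point effective_name_id).
Qed.

Lemma hard_supremum : hard _ supremum.
Proof.
  exact (hard_of_finder _ _ _ _ _ _ finder_supremum first_order_sup decides_mem_irrational
    effective_mem_irrational effective_sample_sup
    (effective_name_point _ (fun W0 base _ tau _ => effective_test_sup base tau))).
Qed.

Lemma hard_cont_set : hard _ cont_set.
Proof.
  exact (hard_of_finder _ _ _ _ _ _ finder_cont_set first_order_set decides_mem_irrational
    effective_mem_irrational effective_sample_set
    (effective_name_point _ (fun W0 base _ tau _ => effective_test_set base tau))).
Qed.

Lemma hard_cont_modulus : hard _ cont_modulus.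
Proof.
  exact (hard_of_finder _ _ _ _ _ _ finder_cont_modulus first_order_mod decides_mem_irrational
    effective_mem_irrational effective_sample_mod
    (effective_name_point _ (fun W0 base _ tau _ => effective_test_mod base tau))).
Qed.

Lemma hard_cont_approx : hard _ cont_approx.
Proof.
  exact (hard_of_finder _ _ _ _ _ _ finder_cont_approx first_order_approx decides_mem_irrational
    effective_mem_irrational effective_sample_approx
    (effective_name_point _ (fun W0 base i tau H => effective_test_approx base i H tau))).
Qed.

Lemma hard_conclusions t P : hard t P ->
  not_computable_in_any_S2k _ (solves t P) /\ computes_Cantor_realiser _ (solves t P) /\
  not_computable_in_any_S2k _ (solves_with_osc t P) /\
  computes_Cantor_realiser _ (solves_with_osc t P).
Proof.
  intros [H1 H2]. split; [|split; [|split]].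
  - intros k _ Phi HPhi. apply (H1 (S2k k) 1%nat). now apply solves_solves_spikes.
  - intros Phi HPhi. apply (H2 0%nat Phi). now apply solves_solves_spikes.
  - intros k _ Phi HPhi. apply (H1 (S2k k) 2%nat). now apply solves_with_osc_solves_spikes.
  - intros Phi HPhi. apply (H2 1%nat Phi). now apply solves_with_osc_solves_spikes.
Qed.

Theorem theorem2p15 :
  (not_computable_in_any_S2k _ (solves _ cont_point) /\
   not_computable_in_any_S2k _ (solves _ supremum) /\
   not_computable_in_any_S2k _ (solves _ cont_set) /\
   not_computable_in_any_S2k _ (solves _ cont_modulus) /\
   not_computable_in_any_S2k _ (solves _ cont_approx)) /\
  (computes_Cantor_realiser _ (solves _ cont_point) /\
   computes_Cantor_realiser _ (solves _ supremum) /\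
   computes_Cantor_realiser _ (solves _ cont_set) /\
   computes_Cantor_realiser _ (solves _ cont_modulus) /\
   computes_Cantor_realiser _ (solves _ cont_approx)) /\
  (not_computable_in_any_S2k _ (solves_with_osc _ cont_point) /\
   not_computable_in_any_S2k _ (solves_with_osc _ supremum) /\
   not_computable_in_any_S2k _ (solves_with_osc _ cont_set) /\
   not_computable_in_any_S2k _ (solves_with_osc _ cont_modulus) /\
   not_computable_in_any_S2k _ (solves_with_osc _ cont_approx)) /\
  (computes_Cantor_realiser _ (solves_with_osc _ cont_point) /\
   computes_Cantor_realiser _ (solves_with_osc _ supremum) /\
   computes_Cantor_realiser _ (solves_with_osc _ cont_set) /\
   computes_Cantor_realiser _ (solves_with_osc _ cont_modulus) /\
   computes_Cantor_realiser _ (solves_with_osc _ cont_approx)).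
Proof.
  pose proof (hard_conclusions _ _ hard_cont_point).
  pose proof (hard_conclusions _ _ hard_supremum).
  pose proof (hard_conclusions _ _ hard_cont_set).
  pose proof (hard_conclusions _ _ hard_cont_modulus).
  pose proof (hard_conclusions _ _ hard_cont_approx).
  tauto.
Qed.
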